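(* Let $R$ be a real closed field, $A=R[x_1,\dots,x_n]$ and $\alpha,\beta\in\mathrm{Sper}\,A$. Put $\mu=\nu_\alpha(\langle\alpha,\beta\rangle)$. Assume that (i) for every $a\in\nu_\alpha(A\setminus\mathfrak p_\alpha)$ with $a\le\mu$, the ideal $P_a$ is generated by monomials in $x_1,\dots,x_n$; (ii) for every $a\in\nu_\alpha(A\setminus\mathfrak p_\alpha)$ with $a<\mu$, $\dim_R (P_a/P_{a+})=1$. Let $g_1,\dots,g_s$ be a finite collection of elements of $A\setminus\langle\alpha,\beta\rangle$. Then there exists a connected set $C\subset\mathrm{Sper}\,A$ such that $\alpha,\beta\in C$ and $C\cap\{g_i=0\}=\emptyset$ for all $i\in\{1,\dots,s\}$ (in other words, $\alpha$ and $\beta$ belong to the same connected component of $\mathrm{Sper}\,A\setminus\{g_1\cdots g_s=0\}$).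
   Context: $\mathrm{Sper}\,A$ is the set of pairs $\alpha=(\mathfrak p_\alpha,\le_\alpha)$ with $\mathfrak p_\alpha$ a prime ideal of $A$ and $\le_\alpha$ a total ordering of $A[\alpha]:=A/\mathfrak p_\alpha$; $f(\alpha)$ is the image of $f\in A$ in $A[\alpha]$. The spectral topology has basic open sets $\{\alpha: f_1(\alpha)>0,\dots,f_k(\alpha)>0\}$; ''connected'' refers to it. $\{g=0\}=\{\delta: g(\delta)=0\}$. The valuation $\nu_\alpha$: let $A(\alpha)=\mathrm{Frac}(A[\alpha])$ with the induced ordering; $R_\alpha=\{x\in A(\alpha): |x|\le_\alpha z\text{ for some }z\in A[\alpha]\}$ is a valuation ring and $\nu_\alpha$ is the corresponding valuation, with value group $\Gamma_\alpha=(A(\alpha)\setminus\{0\})/U(R_\alpha)$, $U(R_\alpha)$ being the units of $R_\alpha$. For $f\in A$, $\nu_\alpha(f)=\nu_\alpha(f\bmod\mathfrak p_\alpha)$, with $\nu_\alpha(0)=\infty$. $\langle\alpha,\beta\rangle$ (the separating ideal) is the ideal of $A$ generated by all $f\in A$ with $f(\alpha)\ge0$ and $f(\beta)\le0$, and $\nu_\alpha(\langle\alpha,\beta\rangle)=\min\{\nu_\alpha(f): f\in\langle\alpha,\beta\rangle\}$ (possibly $\infty$). For $a\in\Gamma_\alpha$, $P_a=\{y\in A:\nu_\alpha(y)\ge a\}$ and $P_{a+}=\{y\in A:\nu_\alpha(y)>a\}$. *)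

(* Defs.v *)
(* MathComp, with the classical topology layer of MathComp-Analysis *)
From HB Require Import structures.
From mathcomp Require Import all_boot all_order all_algebra.
From mathcomp Require Import generic_quotient ring_quotient fraction.
From mathcomp Require Import boolp classical_sets topology.
From mathcomp Require Import mpoly ring.
Set Implicit Arguments.
Unset Strict Implicit.
Unset Printing Implicit Defensive.
Import Order.TTheory GRing.Theory.
Local Open Scope ring_scope.
Local Open Scope quotient_scope.
Local Open Scope classical_set_scope.

(* The library only makes the quotient by a prime ideal a commutative ring; its
   integral domain structure, with a classically chosen inverse, is needed to
   form the field of fractions. *)
Section QuotientDomain.
Variables (A : comNzRingType) (p : prime_idealr A).
Local Notation B := {ideal_quot p}.

Definition quot_unit : pred B := fun x => `[< exists y, y * x = 1 >].

Definition quot_inv (x : B) : B := xget x [set y | y * x = 1].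

Lemma quot_mulVx : {in quot_unit, left_inverse 1 quot_inv *%R}.
Proof.
move=> x /asboolP [y yx]; rewrite /quot_inv.
by case: xgetP => [z _ //|/(_ y)].
Qed.

Lemma quot_unitP (x y : B) : y * x = 1 -> quot_unit x.
Proof. by move=> yx; apply/asboolP; exists y. Qed.

Lemma quot_inv_out : {in [predC quot_unit], quot_inv =1 id}.
Proof.
move=> x /negP nx; rewrite /quot_inv; case: xgetP => // y _ yx.
by case: nx; apply: quot_unitP yx.
Qed.

HB.instance Definition _ := GRing.ComNzRing_hasMulInverse.Build B
  quot_mulVx quot_unitP quot_inv_out.

HB.instance Definition _ := GRing.ComUnitRing_isIntegral.Build B
  (@Quotient.rquot_IdomainAxiom A p).

End QuotientDomain.

Record total_ring_order (B : comNzRingType) (le : rel B) : Prop := {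
  tro_anti : antisymmetric le;
  tro_trans : transitive le;
  tro_total : total le;
  tro_add : forall x y z, le x y -> le (x + z) (y + z);
  tro_mul : forall x y, le 0 x -> le 0 y -> le 0 (x * y) }.

Lemma frac_repr (B : idomainType) (u : {fraction B}) : exists a b : B,
  b != 0 /\ u = FracField.tofrac a / FracField.tofrac b.
Proof.
elim/quotP: u => r _; exists (\n_r), (\d_r); split; first exact: denom_ratioP.
have d0 : FracField.tofrac (\d_r) != 0.
  by rewrite tofrac_eq0; apply: denom_ratioP.
apply: (mulIf d0); rewrite mulfVK //.
unlock FracField.tofrac; rewrite -[LHS]FracField.pi_mul.
apply/eqmodP; rewrite /= FracField.equivfE /FracField.mulf.
by rewrite !numden_Ratio ?(mulr1, mulf_neq0, denom_ratioP, oner_neq0) // mulrC.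
Qed.

Definition is_prime_ideal (A : comNzRingType) (p : A -> bool) : Prop :=
  idealr_closed p /\ prime_idealr_closed p.

Definition prime_ideal_of (A : comNzRingType) (p : A -> bool)
    (pP : is_prime_ideal p) : prime_idealr A :=
  HB.pack p (isIdealr.Build A p (proj1 pP))
    (isPrimeIdealrClosed.Build A p (proj2 pP)).

(* The support is a bare predicate because the universe of prime_idealr is too
   large for sper A to be the carrier of a set. *)
Record sper (A : comNzRingType) := Sper {
  supp : A -> bool;
  suppP : is_prime_ideal supp;
  sper_le : {ideal_quot (prime_ideal_of suppP)} ->
            {ideal_quot (prime_ideal_of suppP)} -> bool;
  sper_leP : total_ring_order sper_le }.

HB.instance Definition _ (T : choiceType) := isPointed.Build (seq T) [::].

Fact value_display : Order.disp_t. Proof. exact: Order.Disp tt tt. Qed.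

Section RealSpectrum.
Variable A : comNzRingType.
Implicit Types (alpha beta : sper A) (f g : A).

Definition residue alpha := {ideal_quot (prime_ideal_of (suppP alpha))}.
HB.instance Definition _ alpha := GRing.IntegralDomain.on (residue alpha).

Definition sper_lt alpha (x y : residue alpha) := (x != y) && sper_le x y.

Definition ev alpha f : residue alpha := \pi f.

Definition zeros g : set (sper A) := [set delta | ev delta g = 0].

Definition pos_locus (s : seq A) : set (sper A) :=
  [set delta | forall f, f \in s -> sper_lt 0 (ev delta f)].

Lemma pos_locus_cover : \bigcup_(s in [set: seq A]) pos_locus s = setT.
Proof. by apply/seteqP; split=> // delta _; exists [::]. Qed.

Lemma pos_locus_join (s t : seq A) delta : [set: seq A] s -> [set: seq A] t ->
  pos_locus s delta -> pos_locus t delta -> exists u, [/\ [set: seq A] u,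
    pos_locus u delta & pos_locus u `<=` pos_locus s `&` pos_locus t].
Proof.
move=> _ _ hs ht; exists (s ++ t); split=> // [f|epsilon h].
  by rewrite mem_cat => /orP[/hs|/ht].
by split=> f hf; apply: h; rewrite mem_cat hf ?orbT.
Qed.

HB.instance Definition _ := gen_eqMixin (sper A).
HB.instance Definition _ := gen_choiceMixin (sper A).
HB.instance Definition _ :=
  isBaseTopological.Build (sper A) pos_locus_cover pos_locus_join.

Section Valuation.
Variable alpha : sper A.
Local Notation B := (residue alpha).
Local Notation le := (@sper_le A alpha).
Local Notation lt := (@sper_lt alpha).

Definition sfrac := {fraction B}.
HB.instance Definition _ := GRing.Field.on sfrac.
Definition to_sfrac : B -> sfrac := @FracField.tofrac B.

Definition sfrac_le (x y : sfrac) := exists a b : B,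
  [/\ le 0 a, lt 0 b & y - x = to_sfrac a / to_sfrac b].

Definition sfrac_abs (x : sfrac) := if `[< sfrac_le 0 x >] then x else - x.

Definition val_ring : pred sfrac :=
  [pred x | `[< exists z : B, sfrac_le (sfrac_abs x) (to_sfrac z) >]].

Lemma sper_le00 : le 0 0.
Proof. by case/orP: (tro_total (sper_leP alpha) 0 0). Qed.

Lemma sper_le0D (a b : B) : le 0 a -> le 0 b -> le 0 (a + b).
Proof.
move=> a0 b0; apply: (tro_trans (sper_leP alpha) b0).
by rewrite -[X in le X _]add0r; apply: tro_add (sper_leP alpha) _ _ _ a0.
Qed.

Lemma sper_le0N (a : B) : ~~ le 0 a -> le 0 (- a).
Proof.
case/orP: (tro_total (sper_leP alpha) 0 a) => [-> //|].
by move=> /(tro_add (sper_leP alpha) (- a)); rewrite subrr add0r.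
Qed.

Lemma sper_lt0M (a b : B) : lt 0 a -> lt 0 b -> lt 0 (a * b).
Proof.
rewrite /sper_lt ![0 == _]eq_sym => /andP[a0 pa] /andP[b0 pb].
by rewrite mulf_neq0 //= (tro_mul (sper_leP alpha)).
Qed.

Lemma sper_lt01 : lt 0 1.
Proof.
rewrite /sper_lt eq_sym oner_neq0 /=; case: (boolP (le 0 1)) => // n01.
have := tro_mul (sper_leP alpha) (sper_le0N n01) (sper_le0N n01).
by rewrite mulrNN mulr1 (negPf n01).
Qed.

Lemma to_sfrac_neq0 (b : B) : lt 0 b -> to_sfrac b != 0.
Proof. by rewrite /to_sfrac tofrac_eq0 eq_sym => /andP[]. Qed.

Lemma sfrac_le0D x y : sfrac_le 0 x -> sfrac_le 0 y -> sfrac_le 0 (x + y).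
Proof.
move=> [a [b [a0 b0 ex]]] [c [d [c0 d0 ey]]].
exists (a * d + c * b), (b * d); split.
- case/andP: (b0) (d0) => _ b0' /andP[_ d0'].
  by apply: sper_le0D; apply: (tro_mul (sper_leP alpha)).
- exact: sper_lt0M.
rewrite !subr0 in ex ey *; rewrite ex ey addf_div ?to_sfrac_neq0 //.
by rewrite /to_sfrac rmorphD !rmorphM.
Qed.

Lemma sfrac_le0M x y : sfrac_le 0 x -> sfrac_le 0 y -> sfrac_le 0 (x * y).
Proof.
move=> [a [b [a0 b0 ex]]] [c [d [c0 d0 ey]]].
exists (a * c), (b * d); split; first exact: (tro_mul (sper_leP alpha)).
  exact: sper_lt0M.
rewrite !subr0 in ex ey *.
by rewrite ex ey mulf_div /to_sfrac !rmorphM.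
Qed.

Lemma sfrac_leE x y : sfrac_le x y <-> sfrac_le 0 (y - x).
Proof. by rewrite /sfrac_le subr0. Qed.

Lemma sfrac_le0_total x : sfrac_le 0 x \/ sfrac_le 0 (- x).
Proof.
have [a [b [b0 ->]]] : exists a b : B, b != 0 /\ x = to_sfrac a / to_sfrac b.
  exact: frac_repr.
wlog pb : a b b0 / lt 0 b.
  move=> H; case: (boolP (le 0 b)) => [hb|/sper_le0N hb].
    by apply: H => //; rewrite /sper_lt eq_sym b0.
  rewrite -[to_sfrac b]opprK invrN mulrN -mulNr /to_sfrac -!rmorphN.
  by apply: H; rewrite /sper_lt ?oppr_eq0 // eq_sym oppr_eq0 b0.
case: (boolP (le 0 a)) => [ha|/sper_le0N ha]; [left|right].
  by exists a, b; rewrite subr0.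
by exists (- a), b; split=> //; rewrite subr0 /to_sfrac rmorphN mulNr.
Qed.

Lemma sfrac_abs_le x z :
  sfrac_le (sfrac_abs x) z <-> sfrac_le 0 (z - x) /\ sfrac_le 0 (z + x).
Proof.
have key (u v : sfrac) :
    sfrac_le 0 u -> sfrac_le 0 (v - u) -> sfrac_le 0 (v + u).
  move=> hu hv; rewrite -(subrK u v) -addrA.
  by apply: sfrac_le0D => //; apply: sfrac_le0D.
rewrite sfrac_leE /sfrac_abs; case: asboolP => [x0|nx0].
  by split=> [h|[]//]; split=> //; apply: key.
have x0 : sfrac_le 0 (- x) by have [] := sfrac_le0_total x.
rewrite opprK; split=> [h|[]//]; split=> //; apply: key => //.
by rewrite opprK.
Qed.

Lemma sfrac_le00 : sfrac_le 0 0.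
Proof.
by exists 0, 1; rewrite sper_le00 sper_lt01 subrr /to_sfrac rmorph0 mul0r.
Qed.

Lemma sfrac_le01 : sfrac_le 0 1.
Proof.
exists 1, 1; rewrite sper_lt01 subr0 /to_sfrac rmorph1 divr1.
by case/andP: sper_lt01.
Qed.

Lemma val_ringP1 x :
  sfrac_le 0 (1 - x) -> sfrac_le 0 (1 + x) -> x \in val_ring.
Proof.
move=> h1 h2; apply/asboolP; exists 1; apply/sfrac_abs_le.
by rewrite /to_sfrac rmorph1.
Qed.

Lemma val_ring1 : 1 \in val_ring.
Proof.
have h1 := sfrac_le01.
by apply: val_ringP1; rewrite ?subrr; [exact: sfrac_le00 | exact: sfrac_le0D].
Qed.

Lemma val_ringN x : x \in val_ring -> - x \in val_ring.
Proof.
move=> /asboolP[z /sfrac_abs_le[h1 h2]]; apply/asboolP; exists z.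
by apply/sfrac_abs_le; rewrite opprK.
Qed.

Lemma val_ring_total x : x != 0 -> x \in val_ring \/ x^-1 \in val_ring.
Proof.
have key (u : sfrac) : u != 0 -> sfrac_le 0 (u - 1) -> u^-1 \in val_ring.
  move=> u0 h; have pu : sfrac_le 0 u.
    by rewrite -(subrK 1 u); apply: sfrac_le0D h sfrac_le01.
  have pv : sfrac_le 0 u^-1.
    rewrite -[u^-1]mul1r -(mulfV u0) mulrAC -mulrA.
    apply: sfrac_le0M => //; case: (sfrac_le0_total u^-1) => hv.
      exact: sfrac_le0M.
    by rewrite -mulrNN; apply: sfrac_le0M.
  apply: val_ringP1; last exact: sfrac_le0D sfrac_le01 pv.
  by have := sfrac_le0M h pv; rewrite mulrBl mulfV // mul1r.
move=> x0; have [h1|] := sfrac_le0_total (1 - x); last first.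
  by rewrite opprB => /(key _ x0); right.
have [h2|] := sfrac_le0_total (1 + x); first by left; apply: val_ringP1.
rewrite opprD addrC => /key; rewrite oppr_eq0 => /(_ x0) h.
by right; rewrite -[x^-1]opprK -invrN; apply: val_ringN.
Qed.

Lemma val_ringM x y : x \in val_ring -> y \in val_ring -> x * y \in val_ring.
Proof.
move=> /asboolP[z /sfrac_abs_le[h1 h2]] /asboolP[w /sfrac_abs_le[h3 h4]].
apply/asboolP; exists (z * w); apply/sfrac_abs_le.
have -> : to_sfrac (z * w) = to_sfrac z * to_sfrac w by exact: rmorphM.
move: (to_sfrac z) (to_sfrac w) h1 h2 h3 h4 => Z W h1 h2 h3 h4.
have half (u : sfrac) : sfrac_le 0 (u + u) -> sfrac_le 0 u.
  by case: (sfrac_le0_total u) => // hu /sfrac_le0D/(_ hu); rewrite addrK.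
split; apply: half.
  have -> : Z * W - x * y + (Z * W - x * y) =
      (Z - x) * (W + y) + (Z + x) * (W - y).
    by ring.
  by apply: sfrac_le0D; apply: sfrac_le0M.
have -> : Z * W + x * y + (Z * W + x * y) =
    (Z + x) * (W + y) + (Z - x) * (W - y).
  by ring.
by apply: sfrac_le0D; apply: sfrac_le0M.
Qed.

Definition val_unit (x : sfrac) :=
  [&& x != 0, x \in val_ring & x^-1 \in val_ring].

Definition sfrac_nz := {x : sfrac | x != 0}.

Definition val_equiv (x y : sfrac_nz) := val_unit (val x / val y).

Lemma val_unit1 : val_unit 1.
Proof. by rewrite /val_unit oner_neq0 invr1 val_ring1. Qed.

Lemma val_unitV x : val_unit x^-1 = val_unit x.
Proof. by rewrite /val_unit invr_eq0 invrK [X in _ && X]andbC. Qed.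

Lemma val_unitM x y : val_unit x -> val_unit y -> val_unit (x * y).
Proof.
move=> /and3P[x0 xR xVR] /and3P[y0 yR yVR]; rewrite /val_unit invfM.
by rewrite (mulf_neq0 x0 y0) (val_ringM xR yR) (val_ringM xVR yVR).
Qed.

Lemma val_equiv_refl : reflexive val_equiv.
Proof. by move=> x; rewrite /val_equiv (mulfV (valP x)) val_unit1. Qed.

Lemma val_equiv_sym : ssrbool.symmetric val_equiv.
Proof. by move=> x y; rewrite /val_equiv -val_unitV invf_div. Qed.

Lemma val_equiv_trans : transitive val_equiv.
Proof.
move=> y x z xy yz; have := val_unitM xy yz.
by rewrite mulrA (mulfVK (valP y)).
Qed.

Canonical val_equiv_canonical :=
  EquivRel val_equiv val_equiv_refl val_equiv_sym val_equiv_trans.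

Definition value_group := {eq_quot val_equiv}.
HB.instance Definition _ : EqQuotient _ val_equiv value_group :=
  EqQuotient.on value_group.
HB.instance Definition _ := Choice.on value_group.

Definition val_le (a b : value_group) :=
  val (repr b) / val (repr a) \in val_ring.

Lemma val_leE (x y : sfrac_nz) :
  val_le (\pi x) (\pi y) = (val y / val x \in val_ring).
Proof.
rewrite /val_le.
have /eqmodP /and3P[_ a b] : repr (\pi_value_group x) = x %[mod value_group].
  by rewrite reprK.
have /eqmodP /and3P[_ c d] : repr (\pi_value_group y) = y %[mod value_group].
  by rewrite reprK.
move: (repr _) (repr _) a b c d => x' y' a b c d.
rewrite invf_div in b; rewrite invf_div in d.
have chain (u v w : sfrac_nz) : val u / val v \in val_ring ->
    val v / val w \in val_ring -> val u / val w \in val_ring.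
  by move=> uv /(val_ringM uv); rewrite mulrA (mulfVK (valP v)).
by apply/idP/idP => h; [apply: chain d (chain _ _ _ h a)
                       | apply: chain c (chain _ _ _ h b)].
Qed.

Lemma val_le_anti : antisymmetric val_le.
Proof.
move=> a b /andP[h1 h2]; rewrite -[a]reprK -[b]reprK.
apply/eqmodP/and3P; rewrite /= invf_div; split=> //.
exact: mulf_neq0 (valP (repr a)) (invr_neq0 (valP (repr b))).
Qed.

Lemma val_le_trans : transitive val_le.
Proof.
move=> b a c h1 h2; have := val_ringM h2 h1.
by rewrite mulrA (mulfVK (valP (repr b))).
Qed.

Lemma val_le_total : total val_le.
Proof.
move=> a b; apply/orP.
have n0 : val (repr b) / val (repr a) != 0.
  exact: mulf_neq0 (valP (repr b)) (invr_neq0 (valP (repr a))).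
by have := val_ring_total n0; rewrite invf_div.
Qed.

Lemma val_le_refl : reflexive val_le.
Proof. by move=> a; have := val_le_total a a; rewrite orbb. Qed.

HB.instance Definition _ := Order.Le_isPOrder.Build value_display
  value_group val_le_refl val_le_anti val_le_trans.
HB.instance Definition _ := Order.POrder_isTotal.Build value_display
  value_group val_le_total.

(* The value group extended by None = infinity *)
Definition xvalue := option value_group.
HB.instance Definition _ := Choice.on xvalue.

Definition xvalue_le (a b : xvalue) :=
  match a, b with
  | _, None => true
  | None, Some _ => false
  | Some a', Some b' => (a' <= b')%O
  end.

Lemma xvalue_le_refl : reflexive xvalue_le.
Proof. by case=> [a|] //=. Qed.

Lemma xvalue_le_anti : antisymmetric xvalue_le.
Proof. by case=> [a|] [b|] //= /le_anti ->. Qed.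

Lemma xvalue_le_trans : transitive xvalue_le.
Proof. by case=> [a|] [b|] [c|] //=; apply: le_trans. Qed.

Lemma xvalue_le_total : total xvalue_le.
Proof. by case=> [a|] [b|] //=; apply: le_total. Qed.

HB.instance Definition _ := Order.Le_isPOrder.Build value_display
  xvalue xvalue_le_refl xvalue_le_anti xvalue_le_trans.
HB.instance Definition _ := Order.POrder_isTotal.Build value_display
  xvalue xvalue_le_total.

Definition nu_frac (x : sfrac) : xvalue :=
  omap (fun u : sfrac_nz => \pi_value_group u) (insub x).

Definition nu f : xvalue := nu_frac (to_sfrac (ev alpha f)).

Definition nu_ge (a : value_group) : set A :=
  [set y | (Some a <= nu y :> xvalue)%O].

Definition nu_gt (a : value_group) : set A :=
  [set y | (Some a < nu y :> xvalue)%O].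

(* The default value is irrelevant: the minimum exists for every ideal of a
   noetherian ring. *)
Definition nu_min (I : set A) : xvalue :=
  xget None [set m | (nu @` I) m /\ lbound (nu @` I) m].

End Valuation.

Definition ideal (I : set A) := [/\ I 0,
  forall x y, I x -> I y -> I (x + y) & forall a x, I x -> I (a * x)].

Definition ideal_gen (S : set A) : set A := smallest ideal S.

Definition sep_ideal alpha beta : set A :=
  ideal_gen [set f | sper_le 0 (ev alpha f) && sper_le (ev beta f) 0].

End RealSpectrum.

(* The classes of e form a basis of U / W *)
Definition quot_dim (K : nzRingType) (V : lmodType K) (U W : set V) (d : nat) :=
  exists e : 'I_d -> V,
  [/\ forall i, U (e i),
      forall c : 'I_d -> K, W (\sum_i c i *: e i) -> forall i, c i = 0
    & forall u, U u -> exists c : 'I_d -> K, W (u - \sum_i c i *: e i)].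

Definition monomial_ideal (R : comNzRingType) (n : nat) (I : set {mpoly R[n]}) :=
  exists M : set 'X_{1..n}, I = ideal_gen [set 'X_[m] | m in M].

(* Main.v *)
(* Since [<alpha, beta>] is convex for [nu_alpha], an element outside of it has
   [nu_alpha]-value below [mu]; hypotheses (i) and (ii) then force it to have a
   single monomial of minimal value, which dominates all its other monomials.
   Let C be the basic open set on which the variables outside [<alpha, beta>]
   keep their sign at [alpha] and, for each [g_i], the dominant monomial is larger
   than the (suitably scaled) absolute values of the others. Then C contains
   [alpha] and [beta] and misses the zeros of the [g_i].

   C is connected: by Fourier-Motzkin there are natural weights [u] for which
   each dominant monomial has smaller weight than the monomials it dominates.
   A point of C with coordinates [v] in an ordered field K is joined inside C to
   one fixed R-rational point by the paths [v_j t^(u_j)] with t decreasing to a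
   small tau, the segment from [v_j tau^(u_j)] to [p_j tau^(u_j)] with
   [p_j = 1, -1] or [0], and [p_j t^(u_j)] with t increasing to some eta in R.

   A clopen subset of C cannot separate the ends of such a path, even though K is
   not real closed: by compactness of C it is described by finitely many
   polynomials, and over an ordered extension of K in which their product along
   the path has as many roots as possible, each of them changes sign only at one
   of these roots. *)
Require Import Defs.
From HB Require Import structures.
From mathcomp Require Import all_boot all_order all_algebra.
From mathcomp Require Import generic_quotient ring_quotient fraction.
From mathcomp Require Import boolp classical_sets filter topology.
From mathcomp Require Import mpoly zify ring lra.
Set Implicit Arguments.
Unset Strict Implicit.
Unset Printing Implicit Defensive.
Import Order.TTheory GRing.Theory Num.Theory.
Local Open Scope ring_scope.
Local Open Scope classical_set_scope.

(** * Prime cones and points of the real spectrum *)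

(** These are the proper preorderings of real algebra; a [prime_cone] is the set of functions that
    are nonnegative at some point of the real spectrum. *)
Record precone (B : comNzRingType) (P : set B) : Prop := {
  precone_add : forall x y, P x -> P y -> P (x + y);
  precone_mul : forall x y, P x -> P y -> P (x * y);
  precone_sqr : forall x, P (x * x);
  precone_N1 : ~ P (-1) }.

Record prime_cone (B : comNzRingType) (P : set B) : Prop := {
  prime_cone_precone : precone P;
  prime_cone_total : forall x, P x \/ P (- x);
  prime_cone_prime : forall x y, P (x * y) -> P (- (x * y)) ->
    (P x /\ P (- x)) \/ (P y /\ P (- y)) }.

Section Cones.
Variable B : comNzRingType.
Implicit Types (P T : set B) (x y : B).

Lemma precone1 P : precone P -> P 1.
Proof. by move=> /precone_sqr/(_ 1); rewrite mulr1. Qed.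

Lemma precone0 P : precone P -> P 0.
Proof. by move=> /precone_sqr/(_ 0); rewrite mulr0. Qed.

(** The sets of the chain are completed by [T] so that Zorn's lemma also covers the empty chain,
    whose union is empty. *)
Lemma precone_chain T (F : set (set B)) : precone T -> total_on F subset ->
  (forall X, F X -> precone (T `|` X)) -> precone (T `|` \bigcup_(X in F) X).
Proof.
move=> hT tF hF.
have pair x y : (T `|` \bigcup_(X in F) X) x -> (T `|` \bigcup_(X in F) X) y ->
    exists U, [/\ precone U, U x, U y & U `<=` T `|` \bigcup_(X in F) X].
  have sub X : F X -> T `|` X `<=` T `|` \bigcup_(X in F) X.
    by move=> FX z [Tz|Xz]; [left|right; exists X].
  case=> [Tx|[X FX Xx]] [Ty|[Y FY Yy]].
  - by exists T; split=> // z; left.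
  - by exists (T `|` Y); split; [exact: hF|left|right|exact: sub].
  - by exists (T `|` X); split; [exact: hF|right|left|exact: sub].
  have [XY|YX] := tF _ _ FX FY.
    by exists (T `|` Y); split; [exact: hF|right; exact: XY|right|exact: sub].
  by exists (T `|` X); split; [exact: hF|right|right; exact: YX|exact: sub].
split=> [x y hx hy|x y hx hy|x|[]]; last 2 first.
- exact: precone_N1 hT.
- by case=> X FX X1; apply: precone_N1 (hF _ FX) _; right.
- have [U [hU Ux Uy]] := pair _ _ hx hy.
  by apply; apply: precone_add.
- have [U [hU Ux Uy]] := pair _ _ hx hy.
  by apply; apply: precone_mul.
by left; apply: precone_sqr.
Qed.

Lemma precone_maximal T : precone T -> exists P, [/\ T `<=` P, precone P &
  forall Q, precone Q -> P `<=` Q -> Q `<=` P].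
Proof.
move=> hT.
have [X [hX maxX]] := @Zorn_bigcup B [set X | precone (T `|` X)]
  (fun F hF tF => precone_chain hT tF hF).
exists (T `|` X); split=> [z|//|Q hQ sub]; first by left.
have [->|QX] := pselect (Q = X); first by move=> z; right.
case: (maxX Q).
  split=> [z Xz|QsubX]; first by apply: sub; right.
  by apply: QX; apply/seteqP; split=> // z Xz; apply: sub; right.
suff -> : [set X | precone (T `|` X)] Q = precone Q by [].
congr precone.
by apply/seteqP; split=> z; [case=> // Tz; apply: sub; left|right].
Qed.

Definition precone_adjoin P x := [set z | exists p q, [/\ P p, P q & z = p + q * x]].

(** By maximality, adjoining an [x] outside [P] produces [-1], that is, an identity
    [q * (- x) = 1 + p]. Multiplying two such identities puts [-1] in [P] itself: those for [x] and
    [- x] give totality, those for two elements off the support give primality. *)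
Lemma maximal_precone_prime P : precone P ->
  (forall Q, precone Q -> P `<=` Q -> Q `<=` P) -> prime_cone P.
Proof.
move=> hP maxP.
have P0 := precone0 hP; have P1 := precone1 hP.
have PD := precone_add hP; have PM := precone_mul hP.
have adj x : ~ P x -> exists p q, [/\ P p, P q & q * (- x) = 1 + p].
  move=> nPx; apply: contrapT => nopq; apply: nPx.
  have hQ : precone (precone_adjoin P x).
    split.
    - move=> _ _ [p [q [Pp Pq ->]]] [p' [q' [Pp' Pq' ->]]].
      by exists (p + p'), (q + q'); split; [exact: PD|exact: PD|ring].
    - move=> _ _ [p [q [Pp Pq ->]]] [p' [q' [Pp' Pq' ->]]].
      exists (p * p' + q * q' * (x * x)), (p * q' + q * p').
      split; [|by apply: (PD); apply: (PM)|by ring].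
      by apply: (PD); apply: (PM) => //; [exact: PM|exact: precone_sqr].
    - move=> z; exists (z * z), 0; split=> //; first exact: precone_sqr.
      by rewrite mul0r addr0.
    case=> p [q [Pp Pq e]]; apply: nopq; exists p, q; split=> //.
    have -> : q * - x = p - (p + q * x) by ring.
    by rewrite -e; ring.
  apply: (maxP _ hQ) => [z Pz|].
    by exists z, 0; rewrite mul0r addr0.
  by exists 0, 1; rewrite mul1r add0r.
have P_total x : P x \/ P (- x).
  apply: contrapT => /not_orP[/adj[p [q [Pp Pq e]]] /adj[p' [q' [Pp' Pq' e']]]].
  apply: (precone_N1 hP).
  have -> : -1 = (p + p' + p * p') + (q * q') * (x * x).
    have : (q * - x) * (q' * - - x) = (1 + p) * (1 + p') by rewrite e e'.
    rewrite opprK => h.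
    have -> : q * q' * (x * x) = - ((q * - x) * (q' * x)) by ring.
    by rewrite h; ring.
  by do !apply: (PD) => //; apply: (PM) => //; [exact: PM|exact: precone_sqr].
split=> // x y Pxy PNxy; apply: contrapT => /not_orP[nx ny].
have sgn z : ~ (P z /\ P (- z)) -> exists p q, P p /\ q * z = 1 + p.
  move=> nz; have [Pz|PNz] := P_total z.
    have /adj[p [q [Pp Pq]]] : ~ P (- z) by move=> h; apply: nz.
    by rewrite opprK; exists p, q.
  have /adj[p [q [Pp Pq e]]] : ~ P z by move=> h; apply: nz.
  by exists p, (- q); rewrite mulNr -mulrN.
have [p [q [Pp e]]] := sgn _ nx; have [p' [q' [Pp' e']]] := sgn _ ny.
have sup w : P (- (w * (x * y))).
  by have [Pw|PNw] := P_total w; [rewrite -mulrN|rewrite -mulNr]; apply: (PM).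
apply: (precone_N1 hP).
have -> : -1 = - (q * q' * (x * y)) + (p + p' + p * p').
  have -> : q * q' * (x * y) = (q * x) * (q' * y) by ring.
  by rewrite e e'; ring.
by do !apply: (PD) => //; apply: (PM).
Qed.

Lemma precone_extend T : precone T -> exists2 P, T `<=` P & prime_cone P.
Proof.
by move=> /precone_maximal[P [sub hP /(maximal_precone_prime hP)]]; exists P.
Qed.

Definition cone_supp P : {pred B} := fun x => `[<P x /\ P (- x)>].

Lemma cone_suppP P : prime_cone P -> is_prime_ideal (cone_supp P).
Proof.
move=> [hP tP pP]; have P0 := precone0 hP.
have PD := precone_add hP; have PM := precone_mul hP.
split; first split.
- by apply/asboolP; rewrite oppr0.
- by apply/negP => /asboolP[_ /(precone_N1 hP)].
- move=> a u v /asboolP[Pu PNu] /asboolP[Pv PNv]; apply/asboolP.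
  have [Pau PNau] : P (a * u) /\ P (- (a * u)).
    have [Pa|PNa] := tP a; first by rewrite -mulrN; split; apply: (PM).
    by rewrite -mulNr -[X in P X /\ _]mulrNN; split; apply: (PM).
  by rewrite opprD; split; apply: (PD).
move=> u v /asboolP[Puv PNuv]; apply/orP.
by have [h|h] := pP _ _ Puv PNuv; [left|right]; apply/asboolP.
Qed.

Section ConePoint.
Variables (P : set B) (hP : prime_cone P).
Let I := prime_ideal_of (cone_suppP hP).
Let hP' := prime_cone_precone hP.

Definition cone_le (x y : {ideal_quot I}) : bool := `[<P (repr y - repr x)>].

Lemma cone_le_pi (f g : B) :
  cone_le (\pi_({ideal_quot I})%qT f) (\pi_({ideal_quot I})%qT g) <-> P (g - f).
Proof.
have rep (h : B) : exists2 e, repr (\pi_({ideal_quot I})%qT h) = h + e &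
    P e /\ P (- e).
  exists (repr (\pi_({ideal_quot I})%qT h) - h); first by rewrite addrC subrK.
  have /eqmodP : (\pi_({ideal_quot I}) (repr (\pi_({ideal_quot I}) h))
    = \pi_({ideal_quot I}) h)%qT by rewrite reprK.
  by rewrite /= Quotient.equivE => /asboolP.
rewrite /cone_le; have [e -> [Pe PNe]] := rep f; have [d -> [Pd PNd]] := rep g.
rewrite asboolE; split=> h.
  have -> : g - f = g + d - (f + e) + (e - d) by ring.
  by do 2?apply: precone_add => //.
have -> : g + d - (f + e) = (g - f) + (d - e) by ring.
by do 2?apply: precone_add => //.
Qed.

Lemma cone_le_total_ring_order : total_ring_order cone_le.
Proof.
split.
- move=> x y; rewrite -[x]reprK -[y]reprK => /andP[].
  move=> /cone_le_pi h /cone_le_pi h'; apply/eqmodP.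
  by rewrite /= Quotient.equivE; apply/asboolP; rewrite opprB.
- move=> y x z; rewrite -[x]reprK -[y]reprK -[z]reprK.
  move=> /cone_le_pi h /cone_le_pi h'; apply/cone_le_pi.
  have -> : repr z - repr x = (repr y - repr x) + (repr z - repr y) by ring.
  exact: precone_add.
- move=> x y; rewrite -[x]reprK -[y]reprK; apply/orP.
  have [h|] := prime_cone_total hP (repr y - repr x); first by left; apply/cone_le_pi.
  by rewrite opprB => h; right; apply/cone_le_pi.
- move=> x y z; rewrite -[x]reprK -[y]reprK -[z]reprK => /cone_le_pi h.
  rewrite -!rmorphD; apply/cone_le_pi.
  by have -> : repr y + repr z - (repr x + repr z) = repr y - repr x by ring.
move=> x y; rewrite -[x]reprK -[y]reprK.
rewrite -(rmorph0 (\pi_({ideal_quot I})%qT)) -rmorphM.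
move=> /cone_le_pi; rewrite subr0 => h /cone_le_pi; rewrite subr0 => h'.
by apply/cone_le_pi; rewrite subr0; apply: precone_mul.
Qed.

Lemma prime_cone_sper :
  exists delta : sper B, forall f, sper_le 0 (ev delta f) <-> P f.
Proof.
exists (Sper cone_le_total_ring_order) => f.
rewrite /ev -(rmorph0 (\pi_({ideal_quot I})%qT)) -[P f]/(P f) -[X in P X]subr0.
exact: cone_le_pi.
Qed.

End ConePoint.
End Cones.

(** * The ordered residue field of a point *)

Section SperField.
Variables (A : comNzRingType) (alpha : sper A).
Implicit Types (x y : sfrac alpha) (f g : A).

Lemma to_sfrac_ge0 (b : residue alpha) :
  sfrac_le 0 (to_sfrac b) <-> sper_le 0 b.
Proof.
have lt01 := sper_lt01 alpha.
split=> [|b0]; last first.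
  by exists b, 1; rewrite subr0 /to_sfrac rmorph1 divr1.
case=> c [d [c0 /andP[nd d0]]]; rewrite subr0 => e.
have {e} e : b * d = c.
  apply/eqP; rewrite -tofrac_eq tofracM; apply/eqP.
  change (to_sfrac b * to_sfrac d = to_sfrac c).
  by rewrite e mulfVK // to_sfrac_neq0 // /sper_lt nd.
apply: contrapT => /negP nb; have b0 := sper_le0N nb.
have := tro_mul (sper_leP alpha) b0 d0; rewrite mulNr e => hN.
have /(@tro_anti _ _ (sper_leP alpha) c 0) c0' : sper_le c 0 && sper_le 0 c.
  rewrite c0 andbT; have := tro_add (sper_leP alpha) c hN.
  by rewrite add0r addNr.
move/eqP: e; rewrite c0' mulf_eq0 [d == _]eq_sym (negPf nd) orbF => /eqP b0'.
by move: nb; rewrite b0' (sper_le00 alpha).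
Qed.

Lemma sfrac_le0_anti x : sfrac_le 0 x -> sfrac_le 0 (- x) -> x = 0.
Proof.
have [a [b [b0 ->]]] := frac_repr x.
wlog pb : a b b0 / sper_le 0 b.
  move=> H; have [hb|/sper_le0N hb] := boolP (sper_le 0 b); first exact: H.
  rewrite -[FracField.tofrac b]opprK invrN mulrN -mulNr -!rmorphN.
  by apply: H => //; rewrite oppr_eq0.
have tb0 : FracField.tofrac b != 0 by rewrite tofrac_eq0.
have sb : sfrac_le 0 (to_sfrac b) by apply/to_sfrac_ge0.
move=> /sfrac_le0M/(_ sb) h1 /sfrac_le0M/(_ sb) h2.
move: h1 h2; rewrite mulNr /to_sfrac mulfVK // => /to_sfrac_ge0 h1.
rewrite -rmorphN => /to_sfrac_ge0 h2.
suff -> : a = 0 by rewrite rmorph0 mul0r.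
apply: (@tro_anti _ _ (sper_leP alpha)); rewrite h1 andbT.
by have := tro_add (sper_leP alpha) a h2; rewrite add0r addNr.
Qed.

Definition sfle x y : bool := `[<sfrac_le x y>].
Definition sflt x y : bool := (y != x) && sfle x y.

Lemma sfle0_add x y : sfle 0 x -> sfle 0 y -> sfle 0 (x + y).
Proof. by move=> /asboolP h /asboolP k; apply/asboolP/sfrac_le0D. Qed.

Lemma sfle0_mul x y : sfle 0 x -> sfle 0 y -> sfle 0 (x * y).
Proof. by move=> /asboolP h /asboolP k; apply/asboolP/sfrac_le0M. Qed.

Lemma sfle0_anti x : sfle 0 x -> sfle x 0 -> x = 0.
Proof.
move=> /asboolP h /asboolP k; apply: sfrac_le0_anti => //.
by move/sfrac_leE: k; rewrite sub0r.
Qed.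

Lemma sfle_sub_ge0 x y : sfle 0 (y - x) = sfle x y.
Proof. by apply/asboolP/asboolP => h; [apply/sfrac_leE|apply/(sfrac_leE x y)]. Qed.

Lemma sfle0_total x : sfle 0 x || sfle x 0.
Proof.
rewrite -[sfle x 0]sfle_sub_ge0 sub0r.
by have [h|h] := sfrac_le0_total x; apply/orP; [left|right]; apply/asboolP.
Qed.

Lemma sfrac_abs_ge0 x : sfle 0 x -> sfrac_abs x = x.
Proof. by rewrite /sfle /sfrac_abs => ->. Qed.

Lemma sfrac_absN x : sfrac_abs (- x) = sfrac_abs x.
Proof.
rewrite /sfrac_abs opprK; case: asboolP => h; case: asboolP => k //.
  by rewrite (sfrac_le0_anti k h) oppr0.
by have [] := sfrac_le0_total x.
Qed.

HB.instance Definition _ := Num.IntegralDomain_isLeReal.Build (sfrac alpha)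
  sfle0_add sfle0_mul sfle0_anti sfle_sub_ge0 sfle0_total sfrac_absN
  sfrac_abs_ge0 (fun _ _ => erefl : sflt _ _ = _).

(* Opaque, so that simplification does not expose the quotient maps. *)
Lemma sper_mor_subproof : {phi : {rmorphism A -> sfrac alpha} |
  forall f, phi f = to_sfrac (ev alpha f)}.
Proof.
by exists (GRing.RMorphism.clone A (sfrac alpha)
  (@FracField.tofrac (residue alpha) \o \pi_(residue alpha)%qT) _).
Qed.

Definition sper_mor := sval sper_mor_subproof.

Lemma sper_morE f : sper_mor f = to_sfrac (ev alpha f).
Proof. exact: (svalP sper_mor_subproof). Qed.

Lemma sper_mor_ge0 f : (0 <= sper_mor f) = sper_le 0 (ev alpha f).
Proof.
rewrite sper_morE; apply/idP/idP; first by move/asboolP => /to_sfrac_ge0.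
by move=> h; apply/asboolP; apply/to_sfrac_ge0.
Qed.

End SperField.

(** * Compactness of basic open sets *)

Section Realization.
Variable A : comNzRingType.
Implicit Types (delta : sper A) (f : A) (s : seq A).

(** A point is handled through any map to an ordered field that induces its signs, so that fields
    can be extended freely. *)
Definition realizes delta (L : realFieldType) (phi : A -> L) :=
  forall f, sper_le 0 (ev delta f) = (0 <= phi f).

Lemma evN delta f : ev delta (- f) = - ev delta f.
Proof. exact: (rmorphN (\pi_(residue delta)%qT)). Qed.

Lemma realizes_sper_mor delta : realizes delta (sper_mor delta).
Proof. by move=> f; rewrite sper_mor_ge0. Qed.

Lemma morphism_cone (L : realFieldType) (phi : {rmorphism A -> L}) :
  prime_cone [set f | 0 <= phi f].
Proof.
split; first split.
- by move=> f g /= hf hg; rewrite rmorphD addr_ge0.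
- by move=> f g /= hf hg; rewrite rmorphM mulr_ge0.
- by move=> f /=; rewrite rmorphM -expr2 sqr_ge0.
- by rewrite /= rmorphN1 oppr_ge0 lt_geF ?ltr01.
- move=> f /=; rewrite rmorphN oppr_ge0.
  by have /orP := le_total 0 (phi f).
move=> f g /=; rewrite !rmorphN rmorphM !oppr_ge0 => h1 h2.
have /eqP : phi f * phi g = 0 by apply/le_anti/andP.
by rewrite mulf_eq0 => /orP[]/eqP ->; rewrite lexx; [left|right].
Qed.

Lemma exists_realizes (L : realFieldType) (phi : {rmorphism A -> L}) :
  exists delta, realizes delta phi.
Proof.
have [delta h] := prime_cone_sper (morphism_cone phi).
by exists delta => f; apply/idP/idP => /h.
Qed.

Section Realizes.
Variables (delta : sper A) (L : realFieldType) (phi : {rmorphism A -> L}).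
Hypothesis dphi : realizes delta phi.

Lemma realizes_eq0 f : (ev delta f == 0) = (phi f == 0).
Proof.
apply/eqP/eqP => h.
  apply/le_anti; rewrite -oppr_ge0 -rmorphN -!dphi evN h.
  by rewrite (oppr0 (residue delta)) sper_le00.
have le0 : sper_le 0 (ev delta f) by rewrite dphi h.
apply: (tro_anti (sper_leP delta)); rewrite le0 andbT.
have : sper_le 0 (ev delta (- f)) by rewrite dphi rmorphN h oppr0.
rewrite evN.
by move/(tro_add (sper_leP delta) (ev delta f)); rewrite add0r addNr.
Qed.

Lemma realizes_gt0 f : sper_lt 0 (ev delta f) = (0 < phi f).
Proof. by rewrite /sper_lt eq_sym realizes_eq0 dphi lt0r. Qed.

Lemma realizes_le0 f : sper_le (ev delta f) 0 = (phi f <= 0).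
Proof.
rewrite -oppr_ge0 -rmorphN -dphi evN.
apply/idP/idP.
  by move/(tro_add (sper_leP delta) (- ev delta f)); rewrite add0r subrr.
by move/(tro_add (sper_leP delta) (ev delta f)); rewrite add0r addNr.
Qed.

Lemma realizes_pos_locus s : pos_locus s delta <-> {in s, forall f, 0 < phi f}.
Proof. by split=> h f /h; rewrite realizes_gt0. Qed.

End Realizes.

Lemma open_pos_locus_nbhs (O : set (sper A)) delta : open O -> O delta ->
  exists2 s, pos_locus s delta & pos_locus s `<=` O.
Proof.
by case=> D _ <- [s Ds sdelta]; exists s => // epsilon h; exists s.
Qed.

(** The cone of a limit point of [G]. An ultrafilter decides every sign condition, which gives
    totality; for primality, if the zero set of [f] is not in [G], then that of [g] is. *)
Lemma ultrafilter_cone (G : set_system (sper A)) : UltraFilter G ->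
  prime_cone [set f | G [set delta | sper_le 0 (ev delta f)]].
Proof.
move=> hG; have GP : ProperFilter G by exact: ultra_proper.
pose L f := [set delta | sper_le 0 (ev delta f)].
have LE f delta : L f delta = (0 <= sper_mor delta f).
  by rewrite /L /= realizes_sper_mor.
split; first split.
- move=> f g hf hg; apply: filterS2 hf hg => delta.
  rewrite -!/(L _ delta) !LE rmorphD => h1 h2; exact: addr_ge0.
- move=> f g hf hg; apply: filterS2 hf hg => delta.
  rewrite -!/(L _ delta) !LE rmorphM => h1 h2; exact: mulr_ge0.
- move=> f /=; apply: filterS (filterT) => delta _.
  by rewrite -!/(L _ delta) !LE rmorphM -expr2 sqr_ge0.
- move=> h; apply: (@filter_not_empty _ G); apply: filterS h => delta.
  by rewrite -!/(L _ delta) !LE rmorphN1 oppr_ge0 ler10.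
- move=> f /=; have [h|h] := in_ultra_setVsetC (L f) hG; [by left|right].
  apply: filterS h => delta; rewrite -!/(L _ delta) /setC /= -/(L _ delta).
  rewrite !LE rmorphN oppr_ge0.
  by have /orP[] := le_total 0 (sper_mor delta f).
move=> f g /= hfg hNfg.
have [h|h] := in_ultra_setVsetC (L f `&` L (- f)) hG.
  by left; split; apply: filterS h => delta [].
have g0 : G [set delta | sper_mor delta g = 0].
  apply: filterS3 hfg hNfg h => delta /= h1 h2 nf.
  move: h1 h2; rewrite -!sper_mor_ge0 rmorphN !rmorphM oppr_ge0 => h1 h2.
  have /eqP : sper_mor delta f * sper_mor delta g = 0 by apply/le_anti/andP.
  rewrite mulf_eq0 => /orP[]/eqP // f0; case: nf.
  by split; rewrite LE ?rmorphN f0 ?oppr0.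
by right; split; apply: filterS g0 => delta /= g0;
  rewrite -sper_mor_ge0 ?rmorphN g0 ?oppr0.
Qed.

(** Without a finite subcover, the parts of [pos_locus s] left over by finite subfamilies generate a
    proper filter; the limit of an ultrafilter containing it is a point of [pos_locus s] that no
    member of the cover can contain. *)
Lemma pos_locus_compact s (P : set (seq A)) :
  pos_locus s `<=` \bigcup_(t in P) pos_locus t ->
  exists2 l : seq (seq A), {in l, forall t, P t} &
    forall delta, pos_locus s delta -> exists2 t, t \in l & pos_locus t delta.
Proof.
move=> cov; apply: contrapT => nol.
pose rest (l : seq (seq A)) : set (sper A) :=
  [set delta | pos_locus s delta /\ forall t, t \in l -> ~ pos_locus t delta].
pose F : set_system (sper A) :=
  [set X | exists2 l, {in l, forall t, P t} & rest l `<=` X].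
have FP : ProperFilter F.
  split.
    case=> l hl sub; apply: nol; exists l => // delta sdelta.
    apply: contrapT => nt; apply: (sub delta); split=> // t tl td.
    by apply: nt; exists t.
  split.
  - by exists [::].
  - move=> X Y [l hl lX] [k hk kY]; exists (l ++ k).
      by move=> t; rewrite mem_cat => /orP[/hl|/hk].
    move=> delta [sd h]; split; [apply: lX|apply: kY]; split=> // t tl;
      by apply: h; rewrite mem_cat tl ?orbT.
  - by move=> X Y XY [l hl lX]; exists l => // delta /lX/XY.
have [G [hG FG]] := ultraFilterLemma FP.
have [delta dG] := prime_cone_sper (ultrafilter_cone hG).
have GP : ProperFilter G by exact: ultra_proper.
(* Strict inequalities pass to the limit and back, because positivity of [f] is the negation of
   nonnegativity of [- f]. *)
have gt0P f : sper_lt 0 (ev delta f) <->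
    G [set epsilon | sper_lt 0 (ev epsilon f)].
  rewrite (realizes_gt0 (realizes_sper_mor delta)) ltNge -oppr_ge0 -rmorphN.
  rewrite sper_mor_ge0; split=> [/negP h|h].
    have [k|] := in_ultra_setVsetC [set epsilon | sper_le 0 (ev epsilon (- f))] hG.
      by case: h; apply/dG.
    apply: filterS => epsilon /= /negP; rewrite -sper_mor_ge0 rmorphN oppr_ge0.
    by rewrite (realizes_gt0 (realizes_sper_mor epsilon)) ltNge.
  apply/negP => /dG k; apply: (@filter_not_empty _ G).
  apply: filterS2 h k => epsilon /=.
  rewrite (realizes_gt0 (realizes_sper_mor epsilon)) -sper_mor_ge0 rmorphN.
  by rewrite oppr_ge0 => /lt_geF ->.
have posP t : pos_locus t delta <-> G (pos_locus t).
  split=> [|h f ft]; last first.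
    by apply/gt0P; apply: filterS h => epsilon; apply.
  elim: t => [|f t IH] h; first by apply: filterS filterT.
  have /gt0P hf : sper_lt 0 (ev delta f) by apply: h; rewrite mem_head.
  have /IH ht : pos_locus t delta.
    by move=> g gt; apply: h; rewrite in_cons gt orbT.
  apply: filterS2 hf ht => epsilon /= ef et g.
  by rewrite in_cons => /orP[/eqP ->|/et].
have /posP/cov[t Pt /posP Gt] : G (pos_locus s).
  by apply: FG; exists [::] => // epsilon [].
apply: (@filter_not_empty _ G).
suff Gc : G (~` pos_locus t) by rewrite -(setICr (pos_locus t)); apply: filterI.
apply: FG; exists [:: t] => [u|epsilon [_]]; first by rewrite inE => /eqP ->.
by apply; rewrite mem_head.
Qed.

(** The basic sets whose trace on [pos_locus s] lies in [C] or misses [C] form a cover; a finite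
    subcover is sorted into these two kinds. *)
Lemma clopen_pos_locus s (C O F : set (sper A)) : open O -> closed F ->
  C = pos_locus s `&` O -> C = pos_locus s `&` F ->
  exists l k : seq (seq A), forall delta, pos_locus s delta ->
    (C delta <-> exists2 t, t \in l & pos_locus t delta) /\
    (~ C delta <-> exists2 t, t \in k & pos_locus t delta).
Proof.
move=> oO cF eO eF.
have oF : open (~` F) by rewrite openC.
pose good (X : set (sper A)) t := pos_locus s `&` pos_locus t `<=` X.
have [l hl cov] : exists2 l : seq (seq A), {in l, forall t, good C t \/ good (~` C) t} &
    forall delta, pos_locus s delta -> exists2 t, t \in l & pos_locus t delta.
  apply: (@pos_locus_compact s [set t | good C t \/ good (~` C) t]) => delta sd.
  have [Cd|nCd] := pselect (C delta).
    have /(open_pos_locus_nbhs oO)[t td tO] : O delta.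
      by move: Cd; rewrite eO => -[].
    by exists t => //; left => e [se te]; rewrite eO; split=> //; apply: tO.
  have /(open_pos_locus_nbhs oF)[t td tF] : (~` F) delta.
    by move=> Fd; apply: nCd; rewrite eF.
  by exists t => //; right => e [se /tF nFe]; rewrite eF => -[].
exists [seq t <- l | `[<good C t>]], [seq t <- l | `[<good (~` C) t>]].
move=> delta sd; have [t tl td] := cov _ sd.
split; split=> [h|[u]]; last 1 first.
- by rewrite mem_filter => /andP[/asboolP gu _ ud]; apply: gu.
- exists t => //; rewrite mem_filter tl andbT; apply/asboolP.
  by have [//|g] := hl _ tl; have := g _ (conj sd td).
- by rewrite mem_filter => /andP[/asboolP gu _ ud]; apply: gu.
exists t => //; rewrite mem_filter tl andbT; apply/asboolP.
by have [g|//] := hl _ tl; have := g _ (conj sd td).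
Qed.

End Realization.

(** * Roots in ordered extensions *)

Section Extensions.

Lemma nonneg_morph_le (K L : realFieldType) (i : {rmorphism K -> L}) :
  (forall x, 0 <= x -> 0 <= i x) -> {mono i : x y / x <= y}.
Proof.
move=> ge0; apply: le_mono => x y xy.
by rewrite lt_neqAle fmorph_eq lt_eqF //= -subr_ge0 -rmorphB ge0 // subr_ge0 ltW.
Qed.

Lemma nonneg_morph_norm (K L : realFieldType) (i : {rmorphism K -> L}) :
  (forall x, 0 <= x -> 0 <= i x) -> forall x, i `|x| = `|i x|.
Proof.
move=> ge0 x; have [x0|x0] := leP 0 x; first by rewrite !ger0_norm ?ge0.
by rewrite !ltr0_norm ?rmorphN // -(rmorph0 i) (leW_mono (nonneg_morph_le ge0)).
Qed.

(** Nonnegative constants of [K] need not be squares; admitting them as weights ensures that the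
    field built in [sign_change_root] extends the order of [K]. *)
Inductive weighted_sos (K : realFieldType) : {poly K} -> Prop :=
| sos0 : weighted_sos 0
| sos_step c h q : 0 <= c -> weighted_sos q ->
    weighted_sos (c *: (h * h) + q).

Section WeightedSos.
Variable K : realFieldType.
Implicit Types (p q h : {poly K}).

Lemma sosD p q : weighted_sos p -> weighted_sos q -> weighted_sos (p + q).
Proof.
elim=> [|c h r c0 _ IH] hq; first by rewrite add0r.
by rewrite -addrA; apply: sos_step (IH hq).
Qed.

Lemma sosM p q : weighted_sos p -> weighted_sos q -> weighted_sos (p * q).
Proof.
move=> hp hq; elim: hp => [|c h r c0 _ IH]; first by rewrite mul0r; apply: sos0.
rewrite mulrDl; apply: sosD => //; elim: hq => [|d k s d0 _ IH'].
  by rewrite mulr0; apply: sos0.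
rewrite mulrDr; have -> : c *: (h * h) * (d *: (k * k)) = (c * d) *: ((h * k) * (h * k)).
  by rewrite -scalerAl -scalerAr scalerA; congr (_ *: _); ring.
by apply: sos_step => //; apply: mulr_ge0.
Qed.

Lemma sos_sqr h : weighted_sos (h * h).
Proof.
have := sos_step h (@ler01 K) (sos0 K).
by rewrite scale1r addr0.
Qed.

Lemma sosC (c : K) : 0 <= c -> weighted_sos c%:P.
Proof.
by move=> /(sos_step 1)/(_ (sos0 K)); rewrite addr0 mulr1 alg_polyC.
Qed.

Lemma sos_horner_ge0 q (L : realFieldType) (i : {rmorphism K -> L}) z :
  (forall x, 0 <= x -> 0 <= i x) -> weighted_sos q -> 0 <= (map_poly i q).[z].
Proof.
move=> ge0; elim=> [|c h r c0 _ IH]; first by rewrite rmorph0 horner0.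
rewrite rmorphD /= hornerD addr_ge0 // map_polyZ hornerZ mulr_ge0 ?ge0 //.
by rewrite rmorphM hornerM -expr2 sqr_ge0.
Qed.

(** Each square is replaced by the square of its remainder. As [size] is the degree plus one, the
    bound for nonconstant [p] says that the degree of [r] is at most twice that of [p] minus two. *)
Lemma sos_modp p q : p != 0 -> weighted_sos q ->
  exists r g, [/\ q = r + g * p, weighted_sos r & (size r <= (size p).*2 - 3)%N].
Proof.
move=> p0; elim=> [|c h s c0 _ [r [g [-> hr sr]]]].
  by exists 0, 0; rewrite mul0r addr0 size_poly0; split=> //; apply: sos0.
pose m := h %% p; pose d := h %/ p.
exists (c *: (m * m) + r), (c *: (d * d * p + d * m + d * m) + g); split.
- have -> : h * h = m * m + (d * d * p + d * m + d * m) * p.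
    by rewrite {1 2}(divp_eq h p) -/m -/d; ring.
  by rewrite scalerDr [in RHS]mulrDl -scalerAl addrACA.
- exact: sos_step.
have sm : (size m < size p)%N by rewrite ltn_modp.
apply: leq_trans (size_polyD _ _) _; rewrite geq_max sr andbT.
apply: leq_trans (size_scale_leq _ _) _; apply: leq_trans (size_polyMleq _ _) _.
by move: (size p) (size m) sm => v u; lia.
Qed.

End WeightedSos.

Lemma morph_poly_horner (K L : comNzRingType) (phi : {rmorphism {poly K} -> L}) q :
  phi q = (map_poly (phi \o polyC) q).[phi 'X].
Proof.
elim/poly_ind: q => [|q c IH]; first by rewrite !rmorph0 horner0.
by rewrite !rmorphD !rmorphM /= IH map_polyX map_polyC hornerD hornerMX hornerC.
Qed.

(* If -1 were a weighted sum of squares modulo p, then reducing the squares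
   modulo p yields 1 + sos = g * p with g of smaller degree, and g changes sign
   because p does; a root of g in an extension would then be a root of 1 + sos. *)
Lemma sign_change_root (K : realFieldType) (p : {poly K}) a b :
  p.[a] < 0 -> 0 < p.[b] ->
  exists (L : realFieldType) (i : {rmorphism K -> L}),
    (forall x, 0 <= x -> 0 <= i x) /\ exists z, root (map_poly i p) z.
Proof.
have [n] := ubnP (size p); elim: n => // n IH in p a b * => /ltnSE sp pa pb.
have p0 : p != 0 by apply: contraTneq pb => ->; rewrite horner0 ltxx.
pose T : set {poly K} := [set q | exists s g, weighted_sos s /\ q = s + g * p].
have hT : precone T.
  split.
  - move=> _ _ [s [g [hs ->]]] [s' [g' [hs' ->]]].
    by exists (s + s'), (g + g'); split; [exact: sosD|ring].
  - move=> _ _ [s [g [hs ->]]] [s' [g' [hs' ->]]].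
    exists (s * s'), (s * g' + g * s' + g * g' * p); split; first exact: sosM.
    by ring.
  - by move=> x; exists (x * x), 0; rewrite mul0r addr0; split=> //; apply: sos_sqr.
  case=> s [g [hs e]].
  have [r [g' [es hr sr]]] := sos_modp p0 hs.
  have e1 : 1 + r = - (g + g') * p.
    have -> : - (g + g') * p = r - (r + g' * p + g * p) by ring.
    by rewrite -es -e; ring.
  have pos (L : realFieldType) (i : {rmorphism K -> L}) z :
      (forall x, 0 <= x -> 0 <= i x) ->
      0 < (map_poly i (- (g + g'))).[z] * (map_poly i p).[z].
    move=> ge0; rewrite -hornerM -rmorphM -e1 rmorphD rmorph1 hornerD hornerC.
    by have := sos_horner_ge0 z ge0 hr; lra.
  have posK z : 0 < (- (g + g')).[z] * p.[z].
    by have := @pos K idfun z (fun x => id); rewrite !map_poly_id.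
  set h := - (g + g') in e1 pos posK.
  have h0 : h != 0 by apply: contraTneq (posK a) => ->; rewrite horner0 mul0r ltxx.
  have sh : (size (- h)%R < n)%N.
    have : (size (h * p)%R <= (size p).*2 - 3)%N.
      rewrite -e1; apply: leq_trans (size_polyD _ _) _; rewrite geq_max sr andbT.
      rewrite size_poly1; suff : (1 < size p)%N by lia.
      rewrite ltnNge; apply/negP => /size1_polyC pc.
      by move: pa pb; rewrite pc !hornerC => /lt_trans h1 /h1; rewrite ltxx.
    rewrite size_polyN size_mul //.
    have : (0 < size h)%N by rewrite size_poly_gt0.
    have : (0 < size p)%N by rewrite size_poly_gt0.
    by move: (size p) (size h) sp => v u; lia.
  have ha : 0 < (- h).[a].
    by have := posK a; rewrite hornerN oppr_gt0 nmulr_lgt0.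
  have hb : (- h).[b] < 0.
    by have := posK b; rewrite hornerN oppr_lt0 pmulr_lgt0.
  have [L [i [ge0 [z]]]] := IH _ _ _ sh hb ha.
  rewrite /root rmorphN hornerN oppr_eq0 => /eqP hz.
  by have := pos L i z ge0; rewrite hz mul0r ltxx.
(* A prime cone containing [T] contains [p] and [- p], so the class of ['X] is a root of [p] in the
   ordered residue field. *)
have [P TP hP] := precone_extend hT.
have [delta hd] := prime_cone_sper hP.
have dphi : forall q, P q -> 0 <= sper_mor delta q.
  by move=> q /hd; rewrite sper_mor_ge0.
exists (sfrac delta), (GRing.RMorphism.clone _ _ (sper_mor delta \o polyC) _).
split=> [c c0|].
  apply/dphi/TP; exists c%:P, 0; rewrite mul0r addr0.
  by split=> //; apply: sosC.
exists (sper_mor delta 'X); rewrite /root -morph_poly_horner.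
apply/eqP/le_anti; rewrite -oppr_ge0 -rmorphN; apply/andP.
split; apply/dphi/TP; [exists 0, (-1)|exists 0, 1]; split; try exact: sos0.
  by rewrite mulN1r add0r.
by rewrite mul1r add0r.
Qed.

(** The number of roots is bounded by [size q], so some extension attains the maximum; a root in a
    further extension that is not among the [rs] would exceed it. *)
Lemma maximal_root_extension (K : realFieldType) (q : {poly K}) : q != 0 ->
  exists (L : realFieldType) (i : {rmorphism K -> L}) (rs : seq L),
    (forall x, 0 <= x -> 0 <= i x) /\
    forall (M : realFieldType) (j : {rmorphism L -> M}),
      (forall x, 0 <= x -> 0 <= j x) ->
      forall z, root (map_poly j (map_poly i q)) z -> z \in map j rs.
Proof.
move=> q0.
pose E k := exists (L : realFieldType) (i : {rmorphism K -> L}) (rs : seq L),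
  [/\ forall x, 0 <= x -> 0 <= i x, uniq rs, all (root (map_poly i q)) rs &
      size rs = k].
have exE : exists k, `[<E k>].
  by exists 0%N; apply/asboolP; exists K, idfun, [::].
have ubE k : `[<E k>] -> (k <= size q)%N.
  move=> /asboolP[L [i [rs [_ u r <-]]]].
  have := max_poly_roots (p := map_poly i q) _ r u.
  by rewrite map_poly_eq0 size_map_poly => /(_ q0)/ltnW.
case: (ex_maxnP exE ubE) => k /asboolP[L [i [rs [ge0 u r <-]]]] maxk.
exists L, i, rs; split=> // M j jge0 z hz; apply: contraT => nz.
have /maxk : `[<E (size rs).+1>]; last by rewrite ltnn.
apply/asboolP; exists M, (GRing.RMorphism.clone _ _ (j \o i) _), (z :: map j rs).
split=> /=; last by rewrite size_map.
- by move=> x /ge0/jge0.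
- by rewrite nz map_inj_uniq //; apply: fmorph_inj.
rewrite -[map_poly _ q]/(map_poly (j \o i) q) map_poly_comp hz /=.
by apply/allP => _ /mapP[y /(allP r) hy ->]; rewrite fmorph_root.
Qed.

Lemma factor_roots (K : fieldType) (f : {poly K}) : f != 0 ->
  exists rs f2, f = f2 * \prod_(r <- rs) ('X - r%:P) /\ forall x, ~~ root f2 x.
Proof.
have [n] := ubnP (size f); elim: n => // n IH in f * => /ltnSE sf f0.
have [[x /factor_theorem[g eg]]|nx] := pselect (exists x, root f x); last first.
  exists [::], f; rewrite big_nil mulr1; split=> // x.
  by apply/negP => rx; apply: nx; exists x.
have g0 : g != 0 by apply: contraNneq f0 => g0; rewrite eg g0 mul0r.
have sg : (size g < n)%N.
  by move: sf; rewrite eg size_Mmonic ?monicXsubC // size_XsubC addn2.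
have [rs [f2 [eg2 h]]] := IH g sg g0.
by exists (x :: rs), f2; split=> //; rewrite eg eg2 big_cons -mulrA [X in _ * X]mulrC.
Qed.

End Extensions.

(** * Sign conditions along an interval *)

Section ConstantSign.
Variables (L : realFieldType) (q : {poly L}) (rs : seq L).
Hypothesis allroots : forall (M : realFieldType) (j : {rmorphism L -> M}),
  (forall x, 0 <= x -> 0 <= j x) ->
  forall z, root (map_poly j q) z -> z \in map j rs.

(** Split off from [f] all its roots in [L]. The remaining factor keeps its sign, since by
    [sign_change_root] it would otherwise have a root in an extension, hence one among the [rs];
    each linear factor has the same sign at [c] and [e] by hypothesis. *)
Lemma no_root_pos f c e : f %| q -> 0 < f.[c] ->
  (forall r, r \in rs -> root f r -> 0 < (c - r) * (e - r)) -> 0 < f.[e].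
Proof.
move=> fq fc nor.
have f0 : f != 0 by apply: contraTneq fc => ->; rewrite horner0 ltxx.
have [us [f2 [ef nf2]]] := factor_roots f0.
have rootrs r : root f r -> r \in rs.
  move=> fr; have := @allroots L idfun (fun x => id) r.
  rewrite map_poly_id // map_id; apply.
  by rewrite -dvdp_XsubCl; apply: dvdp_trans fq; rewrite dvdp_XsubCl.
have prodpos : 0 < (\prod_(r <- us) ('X - r%:P)).[c] * (\prod_(r <- us) ('X - r%:P)).[e].
  rewrite !horner_prod -big_split big_seq /=; elim/big_ind: _ => [||r rus].
  - exact: ltr01.
  - exact: mulr_gt0.
  have fr : root f r by rewrite ef rootM root_prod_XsubC rus orbT.
  by rewrite !hornerXsubC; apply: nor => //; apply: rootrs.
have f2q : f2 %| q by apply: dvdp_trans fq; rewrite ef dvdp_mulr.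
have noch (h : {poly L}) a b : h %| q -> (forall x, ~~ root h x) ->
    h.[a] < 0 -> 0 < h.[b] -> False.
  move=> hq nh ha hb; have [M [j [ge0 [z hz]]]] := sign_change_root ha hb.
  have : root (map_poly j q) z.
    rewrite -dvdp_XsubCl; apply: (@dvdp_trans _ (map_poly j h)).
      by rewrite dvdp_XsubCl.
    by rewrite dvdp_map.
  move=> /(allroots ge0)/mapP[r _ er].
  by move: hz; rewrite er fmorph_root (negPf (nh r)).
have f2n x : f2.[x] != 0 by have := nf2 x.
have f2pos : 0 < f2.[c] * f2.[e].
  have [c0|c0|c0] := ltgtP f2.[c] 0; last by have := f2n c; rewrite c0 eqxx.
    rewrite nmulr_rgt0 // ltNge le_eqVlt eq_sym (negPf (f2n e)) /=.
    by apply/negP => e0; apply: (noch f2 c e).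
  rewrite pmulr_rgt0 // ltNge le_eqVlt (negPf (f2n e)) /=.
  by apply/negP => e0; apply: (noch f2 e c).
have := mulr_gt0 f2pos prodpos; rewrite mulrACA -!hornerM -ef.
by rewrite pmulr_rgt0.
Qed.

Variables (a b : L) (beta : L -> Prop) (l k : seq (seq {poly L})).
Hypothesis lq : forall t f, t \in l -> f \in t -> f != 0 -> f %| q.
Hypothesis kq : forall t f, t \in k -> f \in t -> f != 0 -> f %| q.
Hypothesis betaP : forall c, a <= c <= b ->
  (beta c <-> exists2 t, t \in l & {in t, forall f : {poly L}, 0 < f.[c]}).
Hypothesis nbetaP : forall c, a <= c <= b ->
  (~ beta c <-> exists2 t, t \in k & {in t, forall f : {poly L}, 0 < f.[c]}).

(** No root lies strictly between [c] and [e], in either order, but [e] may be one. A polynomial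
    positive at [c] is thus still positive halfway, and this serves the descriptions of [beta] and
    of its negation alike. *)
Lemma constant_halfway c e : a <= c <= b -> a <= e <= b -> c != e ->
  {in rs, forall r, ~~ (0 < (r - c) * (e - r))} ->
  (beta c <-> beta ((c + e) / 2)).
Proof.
move=> /andP[ac cb] /andP[ae eb] ce nors; set m := (c + e) / 2.
have m2 : m * 2 = c + e by rewrite /m mulfVK // pnatr_eq0.
have mab : a <= m <= b by lra.
have step (f : {poly L}) : (f != 0 -> f %| q) -> 0 < f.[c] -> 0 < f.[m].
  move=> fq fc.
  have f0 : f != 0 by apply: contraTneq fc => ->; rewrite horner0 ltxx.
  apply: no_root_pos (fq f0) (fc) _ => r rrs /eqP fr.
  have rc : r != c by apply: contraTneq fc => <-; rewrite fr ltxx.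
  have := nors r rrs; rewrite -leNgt => h.
  have : 0 < (c - r) ^+ 2 by rewrite exprn_even_gt0 //= subr_eq0 eq_sym.
  have -> : m = (c + e) / 2 by [].
  have -> : (c - r) * ((c + e) / 2 - r) = ((c - r) ^+ 2 - (r - c) * (e - r)) / 2.
    by field.
  by lra.
split=> [|bm].
  move/betaP: (introT andP (conj ac cb)) => bP /bP[t tl tc].
  apply/(betaP mab); exists t => // f ft.
  by apply: step (tc f ft) => f0; apply: lq ft f0.
apply: contrapT => /(nbetaP (introT andP (conj ac cb)))[t tk tc].
suff : ~ beta m by [].
apply/(nbetaP mab); exists t => // f ft.
by apply: step (tc f ft) => f0; apply: kq ft f0.
Qed.

Lemma constant_gap c e : a <= c -> c < e -> e <= b ->
  {in rs, forall r, ~~ (c < r < e)} -> (beta c <-> beta e).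
Proof.
move=> ac ce eb nors.
have cab : a <= c <= b by lra.
have eab : a <= e <= b by lra.
apply: (@iff_trans _ (beta ((c + e) / 2))).
  apply: constant_halfway => // [|r /nors]; first by rewrite lt_eqF.
  apply: contra => h; apply/andP; nra.
rewrite addrC; apply: iff_sym.
apply: constant_halfway => // [|r /nors]; first by rewrite gt_eqF.
by apply: contra => h; apply/andP; nra.
Qed.

(** Induction on the number of listed roots strictly inside the interval, which is cut at such a
    root; [constant_gap] allows roots at the ends. *)
Lemma constant_on_interval : a <= b -> (beta a <-> beta b).
Proof.
have main n (c e : L) : (size [seq r <- rs | c < r < e]%R <= n)%N ->
    a <= c -> c < e -> e <= b -> (beta c <-> beta e).
  elim: n c e => [|n IH] c e sz ac ce eb.
    apply: constant_gap => // r rrs; apply/negP => h.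
    have : r \in [seq r <- rs | c < r < e] by rewrite mem_filter h.
    by move: sz; rewrite leqn0 size_eq0 => /eqP ->.
  have [[r rrs /andP[cr re]]|nr] := pselect (exists2 r, r \in rs & c < r < e);
      last first.
    by apply: constant_gap => // r rrs; apply/negP => h; apply: nr; exists r.
  have less (P : pred L) : ~~ P r -> (forall x, P x -> c < x < e) ->
      (size [seq r <- rs | P r] <= n)%N.
    move=> nPr sub; rewrite -ltnS; apply: leq_trans sz; rewrite !size_filter.
    have r1 : (0 < count_mem r rs)%N by rewrite -has_count has_pred1.
    have : (count P rs + count_mem r rs <= count (fun x => c < x < e)%R rs)%N.
      rewrite -count_predUI [X in (_ + X)%N](@eq_count _ _ pred0) ?count_pred0.
        rewrite addn0; apply: sub_count => x /orP[/sub//|/eqP ->].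
        by rewrite cr.
      by move=> x /=; apply: contraNF nPr => /andP[Px /eqP <-].
    by apply: leq_trans; rewrite -addn1 leq_add2l.
  apply: (@iff_trans _ (beta r)); apply: IH => //; try lra.
    by apply: less => [|x /andP[h1 h2]]; rewrite ?ltxx ?andbF //; apply/andP; split=> //; lra.
  by apply: less => [|x /andP[h1 h2]]; rewrite ?ltxx //; apply/andP; split=> //; lra.
rewrite le_eqVlt => /orP[/eqP ->//|ab].
exact: (main (size [seq r <- rs | a < r < b]%R)).
Qed.

End ConstantSign.

(** * Paths over ordered fields *)

Section Paths.
Variables (R : comNzRingType) (n : nat).
Local Notation A := {mpoly R[n]}.

Lemma mpoly_morph (S : comNzRingType) (phi : {rmorphism A -> S})
    (h : {rmorphism R -> S}) (v : 'I_n -> S) :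
  (forall c, phi c%:MP = h c) -> (forall i, phi 'X_i = v i) ->
  phi =1 mmap h v.
Proof.
move=> hC hX p; rewrite {1}[p]mpolyE rmorph_sum /mmap; apply: eq_bigr => m _.
rewrite -mul_mpolyC rmorphM hC; congr (_ * _).
rewrite -[in LHS]mmap1_id /mmap1 rmorph_prod; apply: eq_bigr => i _.
by rewrite rmorphXn hX.
Qed.

Variables (s : seq A) (C O F : set (sper A)).
Hypotheses (oO : open O) (cF : closed F).
Hypotheses (eO : C = pos_locus s `&` O) (eF : C = pos_locus s `&` F).

(** Points with the same positive functions lie in the same basic open sets; this avoids comparing
    [delta] and [epsilon] as dependent records. *)
Lemma realizes_clopen (K : realFieldType) (phi : {rmorphism A -> K}) delta epsilon :
  realizes delta phi -> realizes epsilon phi -> C delta -> C epsilon.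
Proof.
move=> hd he; have same t : pos_locus t delta -> pos_locus t epsilon.
  by move=> /(realizes_pos_locus hd) h; apply/(realizes_pos_locus he).
rewrite eO => -[sd /(open_pos_locus_nbhs oO)[t td tO]].
by split; [exact: same|apply: tO; apply: same].
Qed.

(** The inequalities describing [C] and its complement become univariate polynomials in the path
    parameter, to which [constant_on_interval] applies. The path must stay in [pos_locus s] over all
    ordered extensions, as the parameters range over one with a maximal set of roots. *)
Lemma clopen_path (K : realFieldType) (h : {rmorphism R -> K})
    (v : 'I_n -> {poly K}) (a b : K) delta epsilon : a <= b ->
  (forall (L : realFieldType) (i : {rmorphism K -> L}),
    (forall x, 0 <= x -> 0 <= i x) -> forall c, i a <= c <= i b ->
    {in s, forall f, 0 < mmap (i \o h) (fun j => (map_poly i (v j)).[c]) f}) ->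
  realizes delta (mmap h (fun j => (v j).[a])) ->
  realizes epsilon (mmap h (fun j => (v j).[b])) ->
  C delta <-> C epsilon.
Proof.
move=> ab hs hd he.
have [l [k hlk]] := clopen_pos_locus oO cF eO eF.
pose g := mmap (polyC \o h : {rmorphism R -> {poly K}}) v.
(* Only nonzero polynomials enter, so that [q] is nonzero and has finitely many roots; each of them
   divides [q]. *)
pose q := \prod_(t <- l ++ k) \prod_(f <- t | g f != 0) g f.
have q0 : q != 0.
  rewrite prodf_seq_neq0; apply/allP => t _ /=; rewrite prodf_seq_neq0.
  by apply/allP => f _; apply/implyP.
have gq t f : t \in l ++ k -> f \in t -> g f != 0 -> g f %| q.
  move=> tlk ft gf; rewrite /q (big_rem t) //= (big_rem f) //= gf.
  by rewrite -mulrA dvdp_mulr.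
have [L [i [rs [ge0 allr]]]] := maximal_root_extension q0.
pose phi c := mmap (i \o h : {rmorphism R -> L}) (fun j => (map_poly i (v j)).[c]).
have phiE c f : (map_poly i (g f)).[c] = phi c f.
  have := @mpoly_morph L
    (GRing.RMorphism.clone _ _ (horner_eval c \o map_poly i \o g) _)
    (i \o h : {rmorphism R -> L}) (fun j => (map_poly i (v j)).[c]) _ _ f.
  apply=> [d|j]; rewrite /= /horner_eval /g ?mmapC ?mmapX ?mmap1U //=.
  by rewrite map_polyC hornerC.
have phiI x f : phi (i x) f = i (mmap h (fun j => (v j).[x]) f).
  have := @mpoly_morph L
    (GRing.RMorphism.clone _ _ (i \o mmap h (fun j => (v j).[x])) _)
    (i \o h : {rmorphism R -> L}) (fun j => (map_poly i (v j)).[i x]) _ _ f.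
  move=> e; rewrite /phi -e // => [d|j]; rewrite /= ?mmapC ?mmapX ?mmap1U //.
  by rewrite horner_map.
have realI x gamma : realizes gamma (mmap h (fun j => (v j).[x])) ->
    realizes gamma (phi (i x)).
  move=> hg f; rewrite hg phiI -(rmorph0 i).
  by rewrite (nonneg_morph_le ge0).
pose beta c := exists2 gamma, realizes gamma (phi c) & C gamma.
have betaI x gamma : realizes gamma (mmap h (fun j => (v j).[x])) ->
    C gamma <-> beta (i x).
  move=> /realI hg; split=> [Cg|[gamma' hg' Cg']]; first by exists gamma.
  exact: realizes_clopen hg' hg Cg'.
rewrite (betaI _ _ hd) (betaI _ _ he).
pose lift := map (map (fun f => map_poly i (g f))).
have liftP (m : seq (seq A)) c gamma : realizes gamma (phi c) ->
    (exists2 t, t \in lift m & {in t, forall f : {poly L}, 0 < f.[c]}) <->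
    (exists2 t, t \in m & pos_locus t gamma).
  move=> hg; split=> [[_ /mapP[t tm ->] pos]|[t tm /(realizes_pos_locus hg) pos]].
    exists t => //; apply/(realizes_pos_locus hg) => f ft.
    by have := pos _ (map_f _ ft); rewrite phiE.
  exists (map (fun f => map_poly i (g f)) t); first exact: map_f.
  by move=> _ /mapP[f ft ->]; rewrite phiE; apply: pos.
have point c : i a <= c <= i b -> exists2 gamma, realizes gamma (phi c) & pos_locus s gamma.
  move=> cab; have [gamma hg] := exists_realizes (phi c : {rmorphism A -> L}).
  by exists gamma => //; apply/(realizes_pos_locus hg); apply: hs.
have dvdlift t f : t \in lift (l ++ k) -> f \in t -> f != 0 -> f %| map_poly i q.
  move=> /mapP[u ulk ->] /mapP[e eu ->]; rewrite map_poly_eq0 dvdp_map.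
  exact: gq ulk eu.
apply: (constant_on_interval allr (l := lift l) (k := lift k)).
- by move=> t f tl; apply: dvdlift; rewrite /lift map_cat mem_cat tl.
- by move=> t f tk; apply: dvdlift; rewrite /lift map_cat mem_cat tk orbT.
- move=> c /point[gamma hg sg]; rewrite (liftP _ _ _ hg) -(proj1 (hlk _ sg)).
  split=> [[gamma' hg' Cg']|Cg]; last by exists gamma.
  exact: realizes_clopen hg' hg Cg'.
- move=> c /point[gamma hg sg]; rewrite (liftP _ _ _ hg) -(proj2 (hlk _ sg)).
  split=> nC; first by move=> Cg; apply: nC; exists gamma.
  by case=> gamma' hg' Cg'; apply: nC; apply: realizes_clopen hg' hg Cg'.
by rewrite (nonneg_morph_le ge0).
Qed.

End Paths.

(** * Weights of monomials *)

Lemma above_all (F : realFieldType) (x : F) (up : seq F) :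
  {in up, forall y, x < y} -> exists2 z, x < z & {in up, forall y, z < y}.
Proof.
elim: up => [|y up IH] h; first by exists (x + 1); rewrite ?ltrDl ?ltr01.
have [|z xz hz] := IH; first by move=> t tu; apply: h; rewrite in_cons tu orbT.
have xy : x < y by apply: h; rewrite mem_head.
have [zy|yz] := ltP z y.
  by exists z => // t; rewrite in_cons => /orP[/eqP ->|/hz].
exists ((x + y) / 2); first by lra.
by move=> t; rewrite in_cons => /orP[/eqP ->|/hz]; lra.
Qed.

Lemma separate_seqs (F : realFieldType) (lo up : seq F) :
  {in lo & up, forall x y, x < y} ->
  exists2 z, {in lo, forall x, x < z} & {in up, forall y, z < y}.
Proof.
elim: lo => [|x lo IH] h.
  elim: up {h} => [|y up [z _ hz]]; first by exists 0.
  exists (Num.min z (y - 1)) => // t; rewrite in_cons gt_min => /orP[/eqP ->|/hz ->//].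
  by rewrite [y - 1 < _]ltrBlDr ltrDl ltr01 orbT.
have [|z lz zu] := IH; first by move=> s t sl tu; apply: h; rewrite // in_cons sl orbT.
have [xz|zx] := ltP x z.
  by exists z => // t; rewrite in_cons => /orP[/eqP ->|/lz].
have [|z' xz' z'u] := @above_all F x up; first by move=> t tu; apply: h; rewrite ?mem_head.
exists z' => // t; rewrite in_cons => /orP[/eqP -> //|/lz tz].
by apply: lt_trans tz _; apply: le_lt_trans xz'.
Qed.

Section Gordan.
Variable n : nat.
Implicit Types (w : 'rV[int]_n) (D : {set 'I_n}) (Pos : 'rV[int]_n -> Prop).

Lemma Pos_scale Pos : (forall v w, Pos v -> Pos w -> Pos (v + w)) ->
  forall (a : int) w, 0 < a -> Pos w -> Pos (a *: w).
Proof.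
move=> add [[//|a]|//] w _ Pw; elim: a => [|a IH]; first by rewrite scale1r.
have -> : Posz a.+2 = Posz a.+1 + 1 by lia.
by rewrite scalerDl scale1r; apply: add.
Qed.

(* Fourier-Motzkin elimination of the coordinates in D. *)
Lemma gordan_rat D Pos (W : seq 'rV[int]_n) :
  (forall v w, Pos v -> Pos w -> Pos (v + w)) ->
  (forall w, {in D, forall j, w 0 j = 0} -> ~ Pos w) ->
  {in W, forall w, Pos w} ->
  exists u : 'I_n -> rat, {in W, forall w, 0 < \sum_(j in D) (w 0 j)%:~R * u j}.
Proof.
have [k] := ubnP #|D|; elim: k => // k IH in D Pos W * => /ltnSE cD add noz hW.
have [D0|[d dD]] := set_0Vmem D.
  exists (fun => 0) => w /hW Pw; exfalso; apply: (noz w) Pw => j.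
  by rewrite D0 inE.
(* Vectors with zero coordinate at [d] are kept; each pair of opposite signs there is replaced by a
   positive combination in which this coordinate cancels. *)
pose Wp := [seq w : 'rV[int]_n <- W | 0 < w 0 d].
pose Wm := [seq w : 'rV[int]_n <- W | w 0 d < 0].
pose comb (p m : 'rV[int]_n) := p 0 d *: m + (- m 0 d) *: p.
pose W' := [seq w : 'rV[int]_n <- W | w 0 d == 0] ++ [seq comb p m | p <- Wp, m <- Wm].
have [||||u hu] := IH (D :\ d)%SET (fun w => Pos w /\ w 0 d = 0) W'.
- have := cardsD1 d D; rewrite dD; move: #|_| #|_| cD => x y; lia.
- by move=> v w [Pv v0] [Pw w0]; split; [exact: add|rewrite mxE v0 w0].
- move=> w w0 [Pw wd]; apply: noz Pw => j jD.
  by have [->//|jd] := eqVneq j d; apply: w0; rewrite !inE jd.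
- move=> w; rewrite mem_cat mem_filter => /orP[/andP[/eqP w0 /hW]//|].
  move=> /allpairsP[[p m] /= [pW mW ->]].
  move: pW mW; rewrite !mem_filter => /andP[p0 /hW Pp] /andP[m0 /hW Pm].
  split; last by rewrite !mxE mulNr mulrC addrN.
  by apply: (add); apply: Pos_scale => //; rewrite oppr_gt0.
pose S (w : 'rV[int]_n) : rat := \sum_(j in (D :\ d)%SET) (w 0 j)%:~R * u j.
(* The inequality for [w] bounds the unknown at [d] by [r w], from below if [w 0 d] is positive and
   from above if it is negative; positivity on [comb p m] puts all lower bounds below all upper
   ones. *)
pose r (w : 'rV[int]_n) : rat := - S w / (w 0 d)%:~R.
have [|x hlo hup] := @separate_seqs rat (map r Wp) (map r Wm).
  move=> _ _ /mapP[p pW ->] /mapP[m mW ->].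
  have : 0 < S (comb p m).
    by apply: hu; rewrite mem_cat; apply/orP; right; apply/allpairsP; exists (p, m).
  have -> : S (comb p m) = (p 0 d)%:~R * S m - (m 0 d)%:~R * S p.
    rewrite /S !mulr_sumr -sumrB; apply: eq_bigr => j _.
    by rewrite !mxE rmorphD rmorphM rmorphM rmorphN /=; ring.
  move: pW mW; rewrite !mem_filter => /andP[p0' _] /andP[m0' _] h.
  have p0 : 0 < (p 0 d)%:~R :> rat by rewrite ltr0z.
  have m0 : (m 0 d)%:~R < 0 :> rat by rewrite ltrz0.
  rewrite /r.
  rewrite ltr_ndivlMr // mulrAC ltr_pdivlMr //; lra.
exists (fun j => if j == d then x else u j) => w wW.
rewrite (big_setD1 d dD) /= eqxx.
have -> : \sum_(j in (D :\ d)%SET) (w 0 j)%:~R * (if j == d then x else u j) = S w.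
  by apply: eq_bigr => j; rewrite !inE => /andP[/negPf -> _].
have [w0|w0|w0] := ltgtP (w 0 d) 0.
- have := hup (r w); rewrite map_f ?mem_filter ?w0 // => /(_ isT).
  by rewrite /r ltr_ndivlMr ?ltrz0 //; lra.
- have := hlo (r w); rewrite map_f ?mem_filter ?w0 // => /(_ isT).
  by rewrite /r ltr_pdivrMr ?ltr0z //; lra.
rewrite w0 mul0r add0r; apply: hu.
by rewrite mem_cat mem_filter w0 eqxx wW.
Qed.

(** The set [Pos] certifies that no nonempty sum of vectors of [W] vanishes. Integrality comes from
    multiplying the rational solution by all denominators. *)
Lemma gordan Pos (W : seq 'rV[int]_n) :
  (forall v w, Pos v -> Pos w -> Pos (v + w)) -> ~ Pos 0 ->
  {in W, forall w, Pos w} ->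
  exists z : 'I_n -> int, {in W, forall w, 0 < \sum_j w 0 j * z j}.
Proof.
move=> add P0 hW; have [|u hu] := @gordan_rat [set: 'I_n]%SET Pos W add _ hW.
  move=> w w0; suff -> : w = 0 by [].
  by apply/rowP => j; rewrite mxE w0 ?inE.
pose d := \prod_i denq (u i).
have d0 : 0 < d by apply: prodr_gt0 => i _; apply: denq_gt0.
exists (fun j => numq (u j) * \prod_(i | i != j) denq (u i)) => w wW.
rewrite -(ltr_int rat) rmorph_sum /=.
have -> : \sum_j (w 0 j * (numq (u j) * \prod_(i | i != j) denq (u i)))%:~R
    = d%:~R * \sum_(j in [set: 'I_n]%SET) (w 0 j)%:~R * u j.
  rewrite mulr_sumr; apply: eq_big => [j|j _]; first by rewrite inE.
  rewrite /d [in RHS](bigD1 j) //= !intrM /= -{3}[u j]divq_num_den.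
  have : (denq (u j))%:~R != 0 :> rat by rewrite intr_eq0 denq_neq0.
  by move=> h; field.
by rewrite mulr_gt0 ?ltr0z ?hu.
Qed.

End Gordan.

(** Exponent vectors whose monomial is infinitely small with respect to [big] are closed under
    addition and exclude [0], so [gordan] applies to differences of exponents. Variables outside [J]
    may vanish; they occur in no [c.2] and get a very large weight. *)
Lemma monomial_weights (n : nat) (K : realFieldType) (big : K -> Prop) (x : 'I_n -> K)
    (J : pred 'I_n) (cs : seq ('X_{1..n} * 'X_{1..n})) :
  (forall j, J j -> x j != 0) -> big 1 ->
  (forall j, J j -> forall z, big z -> z * `|x j| < 1) ->
  (forall c, c \in cs -> (forall j, ~~ J j -> c.2 j = 0%N) /\
    forall z, big z -> z * `|mmap1 x c.1| < `|mmap1 x c.2|) ->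
  exists u : 'I_n -> nat, forall c, c \in cs ->
    (\sum_j c.2 j * u j < \sum_j c.1 j * u j)%N.
Proof.
move=> x0 big1' infJ hcs.
(* Outside [J] the value [1] makes negative powers harmless. *)
pose y j := if J j then x j else 1.
have y0 j : y j != 0 by rewrite /y; case: ifP => [/x0|] //; rewrite oner_neq0.
pose mono (w : 'rV[int]_n) := \prod_j y j ^ w 0 j.
have monoD v w : mono (v + w) = mono v * mono w.
  by rewrite /mono -big_split; apply: eq_bigr => j _; rewrite mxE expfzDr.
pose Pos w := forall z, big z -> z * `|mono w| < 1.
pose inJ (c : 'X_{1..n} * 'X_{1..n}) := [forall j, ~~ J j ==> (c.1 j == 0%N)].
pose wt (c : 'X_{1..n} * 'X_{1..n}) : 'rV[int]_n := \row_j ((c.1 j)%:Z - (c.2 j)%:Z).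
have monoE c : c \in cs -> inJ c -> mono (wt c) = mmap1 x c.1 / mmap1 x c.2.
  move=> ccs /forallP cJ; have [c2 _] := hcs c ccs.
  have out (m : 'X_{1..n}) : (forall j, ~~ J j -> m j = 0%N) -> mmap1 x m = \prod_j y j ^+ m j.
    move=> hm; apply: eq_bigr => j _; rewrite /y; case: ifP => // /negbT /hm ->.
    by rewrite !expr0.
  rewrite !out //; last by move=> j nJ; apply/eqP; have := cJ j; rewrite nJ.
  rewrite -prodf_div; apply: eq_bigr => j _.
  by rewrite mxE expfzDr // -exprnN.
(* The unit vectors at indices in [J] force the weights there to be positive. *)
have [||w|z hz] := @gordan n Pos ([seq wt c | c <- cs & inJ c]
    ++ [seq delta_mx 0 j | j <- enum 'I_n & J j]).
- move=> v w Pv Pw z bz; rewrite monoD normrM mulrA.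
  have := Pw 1 big1'; rewrite mul1r; apply: le_lt_trans.
  by rewrite ler_piMl // ltW // Pv.
- move/(_ 1 big1'); rewrite /mono big1 ?normr1 ?mulr1 ?ltxx // => j _.
  by rewrite mxE expr0z.
- rewrite mem_cat => /orP[/mapP[c]|/mapP[j]]; rewrite mem_filter => /andP[].
    move=> cJ ccs -> z bz; have [_ /(_ z bz) lt] := hcs c ccs.
    have c2pos : 0 < `|mmap1 x c.2|.
      rewrite normr_gt0; apply/prodf_neq0 => j _.
      have [/x0 ?|nJ] := boolP (J j); first exact: expf_neq0.
      by rewrite (proj1 (hcs c ccs)) // expr0 oner_neq0.
    by rewrite monoE // normrM normfV mulrA ltr_pdivrMr // mul1r.
  move=> Jj _ -> z bz; rewrite /mono (bigD1 j) //= big1 => [|i ij].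
    by rewrite mulr1 mxE !eqxx expr1z /y Jj infJ.
  by rewrite mxE (negPf ij) andbF expr0z.
have zJ j : J j -> 0 < z j.
  move=> Jj; have := hz (delta_mx 0 j).
  have dj : delta_mx 0 j \in [seq delta_mx 0 j : 'rV[int]_n | j <- enum 'I_n & J j].
    by apply: map_f; rewrite mem_filter Jj mem_enum.
  rewrite mem_cat dj orbT => /(_ isT).
  rewrite (bigD1 j) //= big1 => [|i ij].
    by rewrite addr0 mxE !eqxx mul1r.
  by rewrite mxE (negPf ij) andbF mul0r.
(* This exceeds the weight of every [c.2], so a [c.1] involving a variable outside [J] is
   automatically heavier. *)
pose U := (\sum_(c <- cs) \sum_j c.2 j * `|z j|).+1%N.
pose u j := if J j then `|z j|%N else U.
exists u => c ccs; have [c2 _] := hcs c ccs.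
have e2 : (\sum_j c.2 j * u j = \sum_j c.2 j * `|z j|%N)%N.
  apply: eq_bigr => j _; rewrite /u; case: ifP => // /negbT /c2 ->.
  by rewrite !mul0n.
have [cJ|] := boolP (inJ c); last first.
  rewrite negb_forall => /existsP[j]; rewrite negb_imply => /andP[nJ cj].
  apply: (@leq_trans U).
    rewrite e2 /U ltnS (big_rem c) //= leq_addr //.
  rewrite (bigD1 j) //= /u (negPf nJ); apply: leq_trans (leq_addr _ _).
  by rewrite leq_pmull // lt0n.
have := hz (wt c); rewrite mem_cat map_f ?mem_filter ?cJ // => /(_ isT) h.
rewrite -ltz_nat -subr_gt0; apply: lt_le_trans h _; rewrite le_eqVlt.
apply/orP/or_introl/eqP; rewrite !(big_morph Posz PoszD (erefl _)) -sumrB.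
apply: eq_bigr => j _; rewrite mxE /u !PoszM mulrBl.
have [Jj|nJ] := boolP (J j); first by rewrite gtz0_abs ?zJ.
move/forallP: cJ => /(_ j); rewrite nJ => /eqP ->.
by rewrite c2 // !mul0r.
Qed.

(** * Connectedness of regions defined by monomial inequalities *)

Section MonomialBounds.
Variables (n : nat) (F : realFieldType).
Implicit Types (m : 'X_{1..n}) (y : 'I_n -> F).

Lemma mmap1_norm y m : `|mmap1 y m| = mmap1 (fun j => `|y j|) m.
Proof. by rewrite /mmap1 normr_prod; apply: eq_bigr => j _; rewrite normrX. Qed.

Lemma mmap1_ge0 y m : (forall j, 0 <= y j) -> 0 <= mmap1 y m.
Proof. by move=> y0; apply: prodr_ge0 => j _; apply: exprn_ge0. Qed.

Lemma mmap1_le y (M : F) m : (forall j, 0 <= y j <= M) -> mmap1 y m <= M ^+ mdeg m.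
Proof.
move=> hy; rewrite mdegE -prodrXr; apply: ler_prod => j _.
by have /andP[y0 yM] := hy j; rewrite exprn_ge0 //= lerXn2r // nnegrE // (le_trans y0).
Qed.

Lemma mmap1_ge (J : pred 'I_n) y (M : F) m : 0 < M ->
  (forall j, J j -> M^-1 <= y j) -> (forall j, ~~ J j -> m j = 0%N) ->
  M ^- mdeg m <= mmap1 y m.
Proof.
move=> M0 hy hm; rewrite -exprVn mdegE -prodrXr; apply: ler_prod => j _.
rewrite exprn_ge0 ?invr_ge0 ?(ltW M0) //=.
have [Jj|nJ] := boolP (J j); last by rewrite hm // !expr0.
have i0 : 0 <= M^-1 by rewrite invr_ge0 ltW.
by rewrite lerXn2r ?nnegrE ?(le_trans i0) ?hy.
Qed.

Lemma mmap1_scale y (t : F) (u : 'I_n -> nat) m :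
  mmap1 (fun j => y j * t ^+ u j) m = mmap1 y m * t ^+ (\sum_j m j * u j).
Proof.
rewrite -prodrXr -big_split; apply: eq_bigr => j _.
by rewrite exprMn -exprM mulnC.
Qed.

(** The larger weight of [m] gives the left side at least one more factor [t], and [t] is at most
    [1]. *)
Lemma mmap1_scale_lt y (c t : F) (u : 'I_n -> nat) m m0 :
  (forall j, 0 <= y j) -> 0 <= c -> 0 < t <= 1 ->
  (\sum_j m0 j * u j < \sum_j m j * u j)%N ->
  c * mmap1 y m * t < mmap1 y m0 ->
  c * mmap1 (fun j => y j * t ^+ u j) m < mmap1 (fun j => y j * t ^+ u j) m0.
Proof.
move=> y0 c0 /andP[t0 t1] wt h; rewrite !mmap1_scale.
have p0 : 0 < t ^+ (\sum_j m0 j * u j) by apply: exprn_gt0.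
apply: le_lt_trans (_ : _ <= c * mmap1 y m * t * t ^+ (\sum_j m0 j * u j)) _; last first.
  by rewrite ltr_pM2r.
rewrite mulrA -[X in _ <= X]mulrA -exprS ler_wpM2l ?mulr_ge0 ?mmap1_ge0 //.
by rewrite ler_wiXn2l // ltW.
Qed.

Lemma mmap1_bounded_lt (J : pred 'I_n) y (M c t : F) m m0 : 0 < M ->
  (forall j, 0 <= y j <= M) -> (forall j, J j -> M^-1 <= y j) ->
  (forall j, ~~ J j -> m0 j = 0%N) -> 0 <= c -> 0 <= t ->
  c * M ^+ (mdeg m + mdeg m0) * t < 1 ->
  c * mmap1 y m * t < mmap1 y m0.
Proof.
move=> M0 hy yJ hm0 c0 t0 h; apply: lt_le_trans (mmap1_ge M0 yJ hm0).
apply: le_lt_trans (_ : _ <= c * M ^+ mdeg m * t) _.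
  by rewrite ler_wpM2r // ler_wpM2l // mmap1_le.
have P0 : 0 < M ^+ mdeg m0 by apply: exprn_gt0.
rewrite -[M ^- _]mul1r ltr_pdivlMr //; apply: le_lt_trans h.
by rewrite exprD le_eqVlt; apply/orP/or_introl/eqP; ring.
Qed.

End MonomialBounds.

(** Nonnegative elements of a real closed field are squares. *)
Lemma rcf_morph_ge0 (R : rcfType) (K : realFieldType) (h : {rmorphism R -> K}) x :
  0 <= x -> 0 <= h x.
Proof. by move=> /sqr_sqrtr <-; rewrite rmorphXn sqr_ge0. Qed.

Section Region.
Variables (R : rcfType) (n : nat) (J : pred 'I_n) (sg : 'I_n -> R).
Variables (cs : seq (R * ('X_{1..n} * 'X_{1..n}))).
Local Notation A := {mpoly R[n]}.
Hypothesis sgP : forall j, `|sg j| = 1.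
Hypothesis cs_supp : forall k, k \in cs -> forall j, ~~ J j -> k.2.2 j = 0%N.

(** An entry [k] of [cs] requires the monomial [k.2.2] to exceed [k.1] times [k.2.1] in absolute
    value. The signs of the variables in [J] make the first absolute value polynomial; the second
    unfolds into two inequalities. *)
Definition region : seq A :=
  [seq sg j *: 'X_j | j <- enum 'I_n & J j] ++
  [seq mmap1 sg k.2.2 *: 'X_[k.2.2] - k.1 *: 'X_[k.2.1] | k <- cs] ++
  [seq mmap1 sg k.2.2 *: 'X_[k.2.2] + k.1 *: 'X_[k.2.1] | k <- cs].

Lemma region_mmap (K : realFieldType) (h : {rmorphism R -> K}) (v : 'I_n -> K) :
  {in region, forall f, 0 < mmap h v f} <->
  (forall j, J j -> 0 < h (sg j) * v j) /\
  (forall k, k \in cs -> `|h k.1| * mmap1 (fun j => `|v j|) k.2.1 <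
                         mmap1 (fun j => `|v j|) k.2.2).
Proof.
have hn := nonneg_morph_norm (rcf_morph_ge0 h).
have eJ : (forall j, J j -> 0 < h (sg j) * v j) -> forall k, k \in cs ->
    h (mmap1 sg k.2.2) * mmap1 v k.2.2 = mmap1 (fun j => `|v j|) k.2.2.
  move=> hJ k kcs; rewrite /mmap1 rmorph_prod -big_split; apply: eq_bigr => j _ /=.
  have [Jj|nJ] := boolP (J j); last by rewrite (cs_supp kcs) // !expr0 rmorph1 mulr1.
  rewrite rmorphXn -exprMn; congr (_ ^+ _).
  by rewrite -(gtr0_norm (hJ j Jj)) normrM -hn sgP rmorph1 mul1r.
have eF k : mmap h v (k.1 *: 'X_[k.2.1]) = h k.1 * mmap1 v k.2.1.
  by rewrite mmapZ mmapX.
split=> [pos|[hJ hcs] f].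
  have hJ j : J j -> 0 < h (sg j) * v j.
    move=> Jj; have := pos (sg j *: 'X_j); rewrite mmapZ mmapX mmap1U; apply.
    rewrite mem_cat; apply/orP; left; apply/mapP; exists j => //.
    by rewrite mem_filter Jj mem_enum.
  split=> // k kcs; rewrite -mmap1_norm -normrM ltr_norml -eJ //.
  rewrite ltrNl -subr_gt0 opprK -[X in _ && X]subr_gt0 -eF.
  have e0 : h (mmap1 sg k.2.2) * mmap1 v k.2.2 = mmap h v (mmap1 sg k.2.2 *: 'X_[k.2.2]).
    by rewrite mmapZ mmapX.
  rewrite e0 -!rmorphB -!rmorphD; apply/andP; split; apply: pos.
    rewrite !mem_cat; apply/orP; right; apply/orP; right; apply/mapP.
    by exists k.
  rewrite !mem_cat; apply/orP; right; apply/orP; left; apply/mapP.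
  by exists k.
rewrite !mem_cat => /orP[/mapP[j]|/orP[]/mapP[k kcs ->]].
- by rewrite mem_filter => /andP[Jj _] ->; rewrite mmapZ mmapX mmap1U hJ.
- rewrite rmorphB /= eF mmapZ mmapX eJ // subr_gt0; apply: le_lt_trans (hcs k kcs).
  by rewrite -mmap1_norm -normrM ler_norm.
rewrite rmorphD /= eF mmapZ mmapX eJ // -[h k.1 * _]opprK subr_gt0.
apply: le_lt_trans (hcs k kcs).
by rewrite -mmap1_norm -normrM -normrN ler_norm.
Qed.

Variable u : 'I_n -> nat.
Hypothesis uP : forall k, k \in cs ->
  (\sum_j k.2.2 j * u j < \sum_j k.2.1 j * u j)%N.

(** At most [1], with product below [1] with the absolute value of each coefficient [k.1]; this puts
    [region_point] in the region. *)
Definition region_eta : R := (1 + \sum_(k <- cs) `|k.1|)^-1.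

Definition region_point (j : 'I_n) : R := (if J j then sg j else 0) * region_eta ^+ u j.

Variables (C O F : set (sper A)).
Hypotheses (oO : open O) (cF : closed F).
Hypotheses (eO : C = pos_locus region `&` O) (eF : C = pos_locus region `&` F).

Lemma region_reach (K : realFieldType) (h : {rmorphism R -> K}) (v : 'I_n -> K)
    delta gamma : pos_locus region delta -> realizes delta (mmap h v) ->
  realizes gamma (mmap (idfun : {rmorphism R -> R}) region_point) ->
  C delta <-> C gamma.
Proof.
move=> sd hd hg.
pose p j := h (if J j then sg j else 0).
have h0 := rcf_morph_ge0 h.
have hn := nonneg_morph_norm h0.
have [vJ vcs] : (forall j, J j -> 0 < h (sg j) * v j) /\
  (forall k, k \in cs -> `|h k.1| * mmap1 (fun j => `|v j|) k.2.1 <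
                         mmap1 (fun j => `|v j|) k.2.2).
  by apply/region_mmap; apply/(realizes_pos_locus hd).
have v0 j : J j -> 0 < `|v j|.
  move=> Jj; rewrite normr_gt0; apply: contraTneq (vJ j Jj) => ->.
  by rewrite mulr0 ltxx.
(* [M] bounds all absolute values of coordinates from above and its inverse bounds those in [J] from
   below; both bounds persist along the segment to [p]. *)
pose M : K := 1 + \sum_j `|v j| + \sum_(j | J j) `|v j|^-1.
have sum1 : 0 <= \sum_j `|v j| by apply: sumr_ge0.
have sum2 : 0 <= \sum_(j | J j) `|v j|^-1 by apply: sumr_ge0 => j _; rewrite invr_ge0.
have M1 : 1 <= M by rewrite /M; lra.
have vM j : `|v j| <= M.
  have : `|v j| <= \sum_j `|v j|.
    by rewrite (bigD1 j) //= lerDl; apply: sumr_ge0.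
  by rewrite /M; lra.
have Mv j : J j -> M^-1 <= `|v j|.
  move=> Jj; rewrite -[`|v j|]invrK lef_pV2 ?posrE ?invr_gt0 ?v0 //; last by lra.
  have : `|v j|^-1 <= \sum_(j | J j) `|v j|^-1.
    rewrite (bigD1 j) //= lerDl; apply: sumr_ge0 => i _; by rewrite invr_ge0.
  by rewrite /M; lra.
(* The constant that [mmap1_bounded_lt] asks to beat; [tau] is small enough for every [k] and does
   not exceed the image of [region_eta]. *)
pose w (k : R * ('X_{1..n} * 'X_{1..n})) : K := `|h k.1| * M ^+ (mdeg k.2.1 + mdeg k.2.2).
pose T : K := 1 + \sum_(k <- cs) w k.
have w0 k : 0 <= w k by rewrite mulr_ge0 // exprn_ge0 //; lra.
have sumw : 0 <= \sum_(k <- cs) w k by apply: sumr_ge0.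
have T0 : 0 < T by rewrite /T; lra.
pose tau := T^-1.
have tau0 : 0 < tau by rewrite invr_gt0.
have tau1 : tau <= 1 by rewrite invf_le1 // /T; lra.
have wT k : k \in cs -> w k * tau < 1.
  move=> kcs; rewrite ltr_pdivrMr // mul1r /T (big_rem k) //=.
  have : 0 <= \sum_(y <- rem k cs) w y by apply: sumr_ge0.
  lra.
have etaK : h region_eta = (1 + \sum_(k <- cs) `|h k.1|)^-1.
  rewrite fmorphV rmorphD rmorph1 rmorph_sum; congr (_ + _)^-1.
  by apply: eq_bigr => k _; rewrite -hn.
have sumc : 0 <= \sum_(k <- cs) `|h k.1| by apply: sumr_ge0.
have tau_eta : tau <= h region_eta.
  rewrite etaK lef_pV2 ?posrE //; last by lra.
  rewrite lerD2l; apply: ler_sum => k _; rewrite ler_peMr // exprn_ege1 //.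
have eta0 : 0 < h region_eta by lra.
have eta1 : h region_eta <= 1 by rewrite etaK invf_le1; lra.
have ceta k : k \in cs -> `|h k.1| * h region_eta < 1.
  move=> kcs; rewrite etaK ltr_pdivrMr; last by lra.
  rewrite mul1r (big_rem k) //=.
  have : 0 <= \sum_(y <- rem k cs) `|h y.1| by apply: sumr_ge0.
  lra.
have sg2 j : h (sg j) * h (sg j) = 1.
  by rewrite -rmorphM -expr2 -real_normK ?num_real // sgP expr1n rmorph1.
(* Common test for the three paths: thanks to the weights, the inequalities for [y] may carry an
   extra factor [t] on the dominated side. *)
have reg (L : realFieldType) (i : {rmorphism K -> L}) (y : 'I_n -> L) t :
    (forall j, J j -> 0 < i (h (sg j)) * y j) -> 0 < t <= 1 ->
    (forall k, k \in cs -> `|i (h k.1)| * mmap1 (fun j => `|y j|) k.2.1 * t <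
      mmap1 (fun j => `|y j|) k.2.2) ->
    {in region, forall f, 0 < mmap (i \o h) (fun j => y j * t ^+ u j) f}.
  move=> yJ /andP[t0 t1] hk.
  apply/(region_mmap (i \o h : {rmorphism R -> L})); split=> [j Jj|k kcs].
    by rewrite mulrA mulr_gt0 ?yJ // exprn_gt0.
  have -> : (fun j => `|y j * t ^+ u j|) = (fun j => `|y j| * t ^+ u j).
    by apply/funext => j; rewrite normrM (gtr0_norm (exprn_gt0 _ t0)).
  by apply: mmap1_scale_lt; rewrite ?t0 ?uP ?hk.
have [d1 hd1] := exists_realizes (mmap h (fun j => v j * tau ^+ u j) : {rmorphism A -> K}).
have [d2 hd2] := exists_realizes (mmap h (fun j => p j * tau ^+ u j) : {rmorphism A -> K}).
have ev_scale (L : realFieldType) (i : {rmorphism K -> L}) (y : 'I_n -> K) c :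
    (fun j => (map_poly i (y j *: 'X^(u j))).[c]) = (fun j => i (y j) * c ^+ u j).
  by apply/funext => j; rewrite map_polyZ map_polyXn hornerZ hornerXn.
have evK (y : 'I_n -> K) c :
    (fun j => (y j *: 'X^(u j)).[c]) = (fun j => y j * c ^+ u j).
  by apply/funext => j; rewrite hornerZ hornerXn.
have pJ j : J j -> p j = h (sg j) by rewrite /p => ->.
have normp j : `|p j| <= 1.
  by rewrite /p -hn; case: ifP => _; rewrite ?sgP ?rmorph1 // normr0 rmorph0.
have mono1 (L : realFieldType) (i : {rmorphism K -> L}) (y : 'I_n -> K) m :
    (forall x, 0 <= x -> 0 <= i x) ->
    mmap1 (fun j => `|i (y j)|) m = i (mmap1 (fun j => `|y j|) m).
  move=> ge0; rewrite /mmap1 rmorph_prod; apply: eq_bigr => j _ /=.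
  by rewrite rmorphXn /= (nonneg_morph_norm ge0).
have igt0 (L : realFieldType) (i : {rmorphism K -> L}) :
    (forall x, 0 <= x -> 0 <= i x) -> forall x y, x < y -> i x < i y.
  by move=> ge0 x y xy; rewrite (leW_mono (nonneg_morph_le ge0)).
have step1 : C d1 <-> C delta.
  have e1 : realizes d1 (mmap h (fun j => (v j *: 'X^(u j)).[tau])) by rewrite evK.
  have e2 : realizes delta (mmap h (fun j => (v j *: 'X^(u j)).[1])).
    rewrite evK; have -> : (fun j => v j * 1 ^+ u j) = v.
      by apply/funext => j; rewrite expr1n mulr1.
    exact: hd.
  apply: (clopen_path oO cF eO eF tau1 _ e1 e2) => L i ge0 c /andP[tc c1].
  rewrite rmorph1 in c1.
  have c0 : 0 < c by apply: lt_le_trans tc; rewrite -(rmorph0 i) igt0.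
  rewrite ev_scale; apply: reg => [j /vJ||k kcs]; last 1 first.
  - rewrite mono1 // mono1 // -(nonneg_morph_norm ge0).
    apply: le_lt_trans (igt0 _ _ ge0 _ _ (vcs k kcs)).
    rewrite rmorphM ler_piMr // mulr_ge0 // ge0 // mmap1_ge0 //.
  - by rewrite -rmorphM => /(igt0 _ _ ge0); rewrite rmorph0.
  by rewrite c0.
pose line j : {poly K} := ((v j)%:P + 'X * (p j - v j)%:P) * (tau ^+ u j)%:P.
have ev_line (L : realFieldType) (i : {rmorphism K -> L}) c :
    (fun j => (map_poly i (line j)).[c]) =
    (fun j => (i (v j) + c * (i (p j) - i (v j))) * i tau ^+ u j).
  apply/funext => j; rewrite /line rmorphM rmorphD rmorphM /= !map_polyC map_polyX.
  rewrite !hornerE; congr ((_ + _ * _) * _); [exact: rmorphB|exact: rmorphXn].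
have ev_lineK c : (fun j => (line j).[c]) =
    (fun j => (v j + c * (p j - v j)) * tau ^+ u j).
  by apply/funext => j; rewrite /line !hornerE.
have step2 : C d1 <-> C d2.
  have e1 : realizes d1 (mmap h (fun j => (line j).[0])).
    rewrite ev_lineK; have -> : (fun j => (v j + 0 * (p j - v j)) * tau ^+ u j)
      = (fun j => v j * tau ^+ u j) by apply/funext => j; rewrite mul0r addr0.
    exact: hd1.
  have e2 : realizes d2 (mmap h (fun j => (line j).[1])).
    rewrite ev_lineK; have -> : (fun j => (v j + 1 * (p j - v j)) * tau ^+ u j)
      = (fun j => p j * tau ^+ u j) by apply/funext => j; rewrite mul1r addrC subrK.
    exact: hd2.
  apply: (clopen_path oO cF eO eF ler01 _ e1 e2) => L i ge0 c.
  rewrite rmorph0 rmorph1 => /andP[c0 c1].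
  have ile := nonneg_morph_le ge0.
  (* On [J], the coordinate times its sign is a convex combination of its initial absolute value and
     [1], so it stays at least the inverse of [M]. *)
  rewrite ev_line; have yJ j : J j -> i (h (sg j)) * (i (v j) + c * (i (p j) - i (v j)))
      = (1 - c) * i (h (sg j) * v j) + c.
    move=> Jj; rewrite pJ // rmorphM; have := congr1 i (sg2 j).
    by rewrite rmorphM rmorph1 => e; ring: e.
  have svJ j : J j -> i M^-1 <= i (h (sg j) * v j).
    move=> Jj; rewrite ile -(gtr0_norm (vJ j Jj)) normrM -hn sgP rmorph1 mul1r.
    exact: Mv.
  have iM1 : i M^-1 <= 1 by rewrite -(rmorph1 i) ile invf_le1 //; lra.
  have iM0 : 0 < i M^-1 by rewrite -(rmorph0 i) igt0 // invr_gt0; lra.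
  have yJge j : J j -> i M^-1 <= (1 - c) * i (h (sg j) * v j) + c.
    by move=> /svJ; nra.
  apply: reg => [j Jj||k kcs].
  - by rewrite yJ //; apply: lt_le_trans (yJge j Jj).
  - by rewrite -(rmorph0 i) -(rmorph1 i) igt0 //= ile.
  apply: (mmap1_bounded_lt (J := J) (M := i M)) => //.
  - by rewrite -(rmorph0 i) igt0 //; lra.
  - move=> j; rewrite normr_ge0 /=.
    have -> : i (v j) + c * (i (p j) - i (v j)) = (1 - c) * i (v j) + c * i (p j) by ring.
    apply: le_trans (ler_normD _ _) _; rewrite !normrM -!(nonneg_morph_norm ge0).
    rewrite (ger0_norm c0) ger0_norm ?subr_ge0 //.
    have h1 : i `|v j| <= i M by rewrite ile.
    have h2 : i `|p j| <= i M by rewrite ile; apply: le_trans M1.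
    by nra.
  - move=> j Jj; rewrite -fmorphV; apply: le_trans (yJge j Jj) _.
    rewrite -yJ //; apply: le_trans (ler_norm _) _.
    by rewrite normrM -(nonneg_morph_norm ge0) -hn sgP !rmorph1 mul1r.
  - exact: cs_supp.
  - by rewrite ge0 // ltW.
  rewrite -(nonneg_morph_norm ge0) -rmorphXn -!rmorphM -(rmorph1 i).
  exact/igt0/wT.
have step3 : C d2 <-> C gamma.
  have e1 : realizes d2 (mmap h (fun j => (p j *: 'X^(u j)).[tau])) by rewrite evK.
  have e2 : realizes gamma (mmap h (fun j => (p j *: 'X^(u j)).[h region_eta])).
    (* [gamma] is given by a morphism to [R]; composing with the order preserving [h] realizes it in
       [K]. *)
    move=> f; rewrite hg evK.
    rewrite -[LHS](nonneg_morph_le h0) rmorph0; congr (_ <= _).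
    apply: (@mpoly_morph _ _ _ (GRing.RMorphism.clone _ _
      (h \o mmap (idfun : {rmorphism R -> R}) region_point) _) h) => [c|j] /=.
      by rewrite mmapC.
    by rewrite mmapX mmap1U /region_point rmorphM rmorphXn.
  apply: (clopen_path oO cF eO eF tau_eta _ e1 e2) => L i ge0 c /andP[tc ch].
  have ile := nonneg_morph_le ge0.
  have c0 : 0 < c by apply: lt_le_trans tc; rewrite -(rmorph0 i) igt0.
  have normip j : J j -> `|i (p j)| = 1.
    by move=> Jj; rewrite -(nonneg_morph_norm ge0) pJ // -hn sgP !rmorph1.
  rewrite ev_scale; apply: reg => [j Jj||k kcs].
  - by rewrite pJ // -rmorphM sg2 rmorph1 ltr01.
  - by rewrite c0 (le_trans ch) // -(rmorph1 i) ile.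
  apply: (mmap1_bounded_lt (J := J) (M := 1)) => //.
  - move=> j; rewrite normr_ge0 -(nonneg_morph_norm ge0) -(rmorph1 i) ile.
    exact: normp.
  - by move=> j /normip ->; rewrite invr1.
  - exact: cs_supp.
  - exact: ltW.
  rewrite expr1n mulr1; apply: le_lt_trans (_ : _ <= `|i (h k.1)| * i (h region_eta)) _.
    by rewrite ler_wpM2l.
  by rewrite -(nonneg_morph_norm ge0) -rmorphM -(rmorph1 i); apply/igt0/ceta.
by rewrite -step1 step2.
Qed.

End Region.

(** The point [gamma] does not depend on [epsilon]; every nonempty clopen subset contains it, and
    with it every point of the region. *)
Lemma region_connected (R : rcfType) (n : nat) (J : pred 'I_n) (sg : 'I_n -> R)
    (cs : seq (R * ('X_{1..n} * 'X_{1..n}))) (u : 'I_n -> nat) :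
  (forall j, `|sg j| = 1) ->
  (forall k, k \in cs -> forall j, ~~ J j -> k.2.2 j = 0%N) ->
  (forall k, k \in cs -> (\sum_j k.2.2 j * u j < \sum_j k.2.1 j * u j)%N) ->
  connected (pos_locus (region J sg cs)).
Proof.
move=> sgP cs_supp uP C [delta Cd] [O oO eO] [F cF eF].
have [gamma hg] := exists_realizes
  (mmap (idfun : {rmorphism R -> R}) (region_point J sg cs u) : {rmorphism {mpoly R[n]} -> R}).
have reach epsilon : pos_locus (region J sg cs) epsilon -> C epsilon <-> C gamma.
  move=> se; pose phi := sper_mor epsilon.
  pose h : {rmorphism R -> sfrac epsilon} :=
    GRing.RMorphism.clone _ _ (phi \o @mpolyC n R) _.
  have he : realizes epsilon (mmap h (fun j => phi 'X_j)).
    by move=> f; rewrite -(@mpoly_morph _ _ _ phi h) // realizes_sper_mor.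
  exact: (region_reach sgP cs_supp uP oO cF eO eF se he hg).
have sub : C `<=` pos_locus (region J sg cs) by rewrite eO => e [].
apply/seteqP; split=> // epsilon se; apply/(reach _ se)/(reach _ (sub _ Cd)).
exact: Cd.
Qed.

(** * Values and the separating ideal *)

(** Trades an absolute value for a ring expression that is nonnegative at every ordering. *)
Lemma norm_le_sqr_add1 (F : realFieldType) (x : F) : `|x| <= x * x + 1.
Proof. by rewrite ler_norml; apply/andP; split; nra. Qed.

Section Values.
Variables (A : comNzRingType) (alpha : sper A).
Local Notation phi := (sper_mor alpha).
Local Notation nu := (nu alpha).
Implicit Types (f g h z : A).

Lemma suppE f : supp alpha f = (phi f == 0).
Proof.
rewrite -(realizes_eq0 (realizes_sper_mor alpha)) /ev.
apply/idP/eqP => [sf|h].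
  rewrite -(rmorph0 (\pi_(residue alpha)%qT)); apply/eqmodP.
  by rewrite /= Quotient.equivE subr0.
rewrite -(rmorph0 (\pi_(residue alpha)%qT)) in h; move/eqmodP: h.
by rewrite /= Quotient.equivE subr0.
Qed.

Lemma val_ringE (x : sfrac alpha) :
  x \in val_ring (alpha := alpha) <-> exists z, `|x| <= phi z.
Proof.
split=> [/asboolP[b hb]|[z hz]].
  exists (repr b); rewrite sper_morE /ev reprK.
  by apply/asboolP.
apply/asboolP; exists (ev alpha z); rewrite -sper_morE.
by move/asboolP: hz.
Qed.

Lemma nu_leE f g : (nu f <= nu g)%O <-> exists z, `|phi g| <= phi z * `|phi f|.
Proof.
rewrite /Defs.nu -!sper_morE /nu_frac.
case: (insubP _ (phi g)) => [y y0 ey|]; last first.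
  rewrite negbK => /eqP ->; split=> _; last by case: (omap _ _).
  by exists 0; rewrite rmorph0 mul0r normr0.
case: (insubP _ (phi f)) => [x x0 ex|]; last first.
  rewrite negbK => /eqP ->; split=> [//|[z]].
  by rewrite normr0 mulr0 normr_le0 (negPf y0).
have -> : (omap (fun u0 : sfrac_nz alpha => \pi_(value_group alpha)%qT u0) (Some x)
    <= omap (fun u0 : sfrac_nz alpha => \pi_(value_group alpha)%qT u0) (Some y)
      :> xvalue alpha)%O = (phi g / phi f \in val_ring (alpha := alpha)).
  by rewrite -ex -ey -val_leE.
rewrite val_ringE; split=> -[z hz]; exists z; move: hz.
  by rewrite normrM normfV ler_pdivrMr ?normr_gt0.
by rewrite normrM normfV ler_pdivrMr ?normr_gt0.
Qed.

Lemma nu_ltE f g : (nu f < nu g)%O <-> forall z, phi z * `|phi g| < `|phi f|.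
Proof.
rewrite ltNge; split=> [/negP h z|h].
  by rewrite ltNge; apply/negP => k; apply/h/nu_leE; exists z.
by apply/negP => /nu_leE[z]; rewrite leNgt h.
Qed.

Lemma nu_None f : nu f = None <-> phi f = 0.
Proof.
rewrite /Defs.nu -sper_morE /nu_frac; case: (insubP _ (phi f)) => [x x0 _|].
  by split=> // h; rewrite h eqxx in x0.
by rewrite negbK => /eqP ->.
Qed.

Lemma nu_leD f g h : (nu f <= nu g)%O -> (nu f <= nu h)%O -> (nu f <= nu (g + h))%O.
Proof.
move=> /nu_leE[z hz] /nu_leE[w hw]; apply/nu_leE; exists (z + w).
rewrite !rmorphD mulrDl; apply: le_trans (ler_normD _ _) _; exact: lerD.
Qed.

Lemma nu_ltD f g h : (nu f < nu g)%O -> (nu f < nu h)%O -> (nu f < nu (g + h))%O.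
Proof.
move=> fg fh; have /orP[gh|hg] := le_total (nu g) (nu h).
  exact: lt_le_trans fg (nu_leD (lexx _) gh).
exact: lt_le_trans fh (nu_leD hg (lexx _)).
Qed.

Lemma nu_leM a f : (nu f <= nu (a * f))%O.
Proof.
apply/nu_leE; exists (a * a + 1); rewrite rmorphM normrM ler_wpM2r //.
by rewrite rmorphD rmorphM rmorph1 norm_le_sqr_add1.
Qed.

Lemma nu_ltM f a g : (nu f < nu g)%O -> (nu f < nu (a * g))%O.
Proof. by move=> h; apply: lt_le_trans h (nu_leM _ _). Qed.

Lemma nu_gt_ideal f : phi f != 0 -> ideal [set h | (nu f < nu h)%O].
Proof.
move=> f0; split=> [|x y|a x] /=; [|exact: nu_ltD|exact: nu_ltM].
by apply/nu_ltE => z; rewrite rmorph0 normr0 mulr0 normr_gt0.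
Qed.

End Values.

Section SeparatingIdeal.
Variables (A : comNzRingType) (alpha beta : sper A).
Local Notation sep := (sep_ideal alpha beta).
Implicit Types (f g h : A).

Lemma ideal_gen_ideal (S : set A) : ideal (ideal_gen S).
Proof.
split=> [I [[I0 _ _] _] //|x y hx hy I hI|a x hx I hI].
  by have [[_ ID _] _] := hI; apply: ID; [exact: hx|exact: hy].
by have [[_ _ IM] _] := hI; apply: IM; exact: hx.
Qed.

Lemma sep_is_ideal : ideal sep.
Proof. exact: ideal_gen_ideal. Qed.

Lemma sepD f g : sep f -> sep g -> sep (f + g).
Proof. by have [_ h _] := sep_is_ideal; apply: h. Qed.

Lemma sepM a f : sep f -> sep (a * f).
Proof. by have [_ _ h] := sep_is_ideal; apply: h. Qed.

Lemma sep_gen f : 0 <= sper_mor alpha f -> sper_mor beta f <= 0 -> sep f.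
Proof.
move=> fa fb; apply: sub_gen_smallest => /=.
by rewrite (realizes_le0 (realizes_sper_mor beta)) -sper_mor_ge0 fa fb.
Qed.

Lemma sep_pos f : ~ sep f -> 0 < sper_mor alpha f -> 0 < sper_mor beta f.
Proof. by move=> nf fa; rewrite ltNge; apply/negP => /(sep_gen (ltW fa)). Qed.

(** If [f] vanished at one of the points, [f] or [- f] would be a generator, according to the sign
    at the other. *)
Lemma sep_neq0 f : ~ sep f -> sper_mor alpha f != 0 /\ sper_mor beta f != 0.
Proof.
move=> nf; have sgn h : ~ sep h -> 0 <= sper_mor alpha h -> ~~ (sper_mor beta h <= 0).
  by move=> nh ha; apply/negP => /(sep_gen ha).
have nNf : ~ sep (- f) by move=> /(sepM (-1)); rewrite mulrNN mul1r.
split; apply/negP => /eqP f0.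
  have := sgn _ nf; have := sgn _ nNf; rewrite !rmorphN f0 oppr0 lexx => h k.
  have /orP[] := le_total 0 (sper_mor beta f).
    by rewrite -oppr_le0 (negPf (h isT)).
  by rewrite (negPf (k isT)).
have := sgn _ nf; have := sgn _ nNf; rewrite !rmorphN f0 oppr0 lexx => h k.
have /orP[/k//|fa] := le_total 0 (sper_mor alpha f).
by have := h; rewrite oppr_ge0 fa => /(_ isT).
Qed.

(* Up to multiplication by a positive element, [g] is dominated at [alpha] by
   each generator [f] with [nu f <= nu g]; then one of [f - g], [f + g] is again
   a generator. *)
Lemma sep_nu_lt f g : ~ sep g -> sep f -> (nu alpha g < nu alpha f)%O.
Proof.
move=> ng; have [ga gb] := sep_neq0 ng.
suff sub : sep `<=` [set f | (nu alpha g < nu alpha f)%O] by apply: sub.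
apply: smallest_sub; first exact: nu_gt_ideal.
move=> e /=; rewrite (realizes_le0 (realizes_sper_mor beta)) -sper_mor_ge0.
move=> /andP[ea eb]; rewrite ltNge; apply/negP => /nu_leE[z hz]; apply: ng.
have [a [za a0 b0]] : exists a, [/\ sper_mor alpha z <= sper_mor alpha a,
    0 <= sper_mor alpha a & 0 <= sper_mor beta a].
  exists (z * z + 1); split; rewrite rmorphD rmorphM rmorph1.
  - exact: le_trans (ler_norm _) (norm_le_sqr_add1 _).
  - exact: le_trans (normr_ge0 _) (norm_le_sqr_add1 _).
  - exact: le_trans (normr_ge0 _) (norm_le_sqr_add1 _).
have ea' : 0 <= sper_mor alpha (a * e) by rewrite rmorphM mulr_ge0.
have eb' : sper_mor beta (a * e) <= 0 by rewrite rmorphM mulr_ge0_le0.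
have sae : sep (a * e) by apply: sep_gen.
have hg : `|sper_mor alpha g| <= sper_mor alpha (a * e).
  apply: le_trans hz _; rewrite rmorphM (ger0_norm ea); exact: ler_wpM2r.
move: hg; rewrite ler_norml => /andP[h1 h2].
have [gb0|gb0] := leP 0 (sper_mor beta g).
  have -> : g = a * e + (-1) * (a * e - g) by ring.
  apply: sepD sae _; apply: sepM; apply: sep_gen; rewrite rmorphB ?subr_ge0 //.
  by rewrite subr_le0 (le_trans eb').
have -> : g = (a * e + g) + (-1) * (a * e) by ring.
apply: sepD; last exact: sepM.
apply: sep_gen; rewrite rmorphD; first by rewrite -lerBlDl sub0r.
by rewrite -[X in _ <= X]addr0 lerD // ltW.
Qed.

Lemma sep_nu_min f : sep f -> sper_mor alpha f != 0 ->
  exists f1 b, [/\ sep f1, nu alpha f1 = Some b &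
    (Some b <= nu_min alpha sep :> xvalue alpha)%O].
Proof.
have fin g : sper_mor alpha g != 0 -> exists b, nu alpha g = Some b.
  by case e : (nu alpha g) => [b|]; [exists b|rewrite (proj1 (nu_None _ _) e) eqxx].
(* If no minimum were attained, [nu_min] would be its default [None], which is above the value of
   [f]. *)
move=> sf f0; rewrite /nu_min; case: xgetP => [m _ [[f1 sf1 <-] lb]|_]; last first.
  by have [b eb] := fin f f0; exists f, b.
have [b eb] : exists b, nu alpha f1 = Some b.
  apply: (fin); apply/eqP => /nu_None e.
  have [c ec] := fin f f0.
  by have := lb (nu alpha f) (imageP _ sf); rewrite e ec.
by exists f1, b; split=> //; rewrite eb.
Qed.

(** Every function positive at [alpha] is then positive at [beta], so [beta] lies in every open set
    around [alpha]. *)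
Lemma sep_trivial_connected : (forall f, sep f -> sper_mor alpha f = 0) ->
  connected [set alpha; beta].
Proof.
move=> triv; have spec (O : set (sper A)) : open O -> O alpha -> O beta.
  move=> oO /(open_pos_locus_nbhs oO)[s sa sO]; apply: sO.
  apply/(realizes_pos_locus (realizes_sper_mor beta)) => f fs.
  have fa := (realizes_pos_locus (realizes_sper_mor alpha) s).1 sa f fs.
  by apply: (sep_pos _ fa) => /triv f0; rewrite f0 ltxx in fa.
move=> B [gamma Bg] [O oO eO] [F cF eF].
have oF : open (~` F) by rewrite openC.
have Ba : B alpha.
  apply: contrapT => nBa; have nFa : (~` F) alpha.
    by move=> Fa; apply: nBa; rewrite eF; split=> //; left.
  have nFb := spec _ oF nFa.
  by move: Bg; rewrite eF => -[[->|->] Fg]; [apply: nFa|apply: nFb].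
have Ob : O beta by apply: spec => //; move: Ba; rewrite eO => -[].
apply/seteqP; split=> [e|e [->|->]]; [by rewrite eO => -[]|by []|].
by rewrite eO; split=> //; right.
Qed.

End SeparatingIdeal.

(** * Dominant monomials *)

Section Monomials.
Variables (R : comNzRingType) (n : nat).
Local Notation A := {mpoly R[n]}.
Implicit Types (f g : A) (m : 'X_{1..n}).

Lemma idealZ (I : set A) (c : R) f : ideal I -> I f -> I (c *: f).
Proof. by move=> [_ _ IM] If; rewrite -mul_mpolyC; apply: IM. Qed.

Lemma ideal_msupp (I : set A) f : ideal I ->
  (forall m, m \in msupp f -> I 'X_[m]) -> I f.
Proof.
move=> hI h; have [I0 ID IM] := hI.
rewrite [f]mpolyE big_seq; elim/big_ind: _ => // m /h; exact: idealZ.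
Qed.

(** The polynomials all of whose monomials lie in [I] form an ideal containing the generators. *)
Lemma monomial_ideal_msupp (I : set A) f m : monomial_ideal I -> I f ->
  m \in msupp f -> I 'X_[m].
Proof.
move=> [M eI] If; have hI : ideal I by rewrite eI; apply: ideal_gen_ideal.
have [I0 ID IM] := hI.
suff sub : I `<=` [set f | forall m, m \in msupp f -> I 'X_[m]] by apply: (sub f If).
rewrite {1}eI; apply: smallest_sub.
  split=> [k|x y hx hy k /msuppD_le|a x hx k /msuppM_le] /=.
  - by rewrite msupp0.
  - by rewrite mem_cat => /orP[/hx|/hy].
  by move=> /allpairsP[[p q] /= [_ /hx Iq ->]]; rewrite mpolyXD; apply: IM.
move=> _ [k Mk <-] l /mem_msuppXP <-; rewrite eI.
by apply: sub_gen_smallest; exists k.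
Qed.

End Monomials.

Section Dominance.
Variables (R : rcfType) (n : nat).
Local Notation A := {mpoly R[n]}.
Variables (alpha beta : sper A) (mu : xvalue alpha).
Local Notation sep := (sep_ideal alpha beta).
Local Notation nu := (nu alpha).
Hypothesis monomial_le : forall a : value_group alpha,
  (exists2 f, ~~ supp alpha f & nu f = Some a) ->
  (Some a <= mu :> xvalue alpha)%O -> monomial_ideal (nu_ge a).
Hypothesis dim1_lt : forall a : value_group alpha,
  (exists2 f, ~~ supp alpha f & nu f = Some a) ->
  (Some a < mu :> xvalue alpha)%O -> quot_dim (nu_ge a) (nu_gt a) 1.
Variables (f1 : A) (b : value_group alpha).
Hypotheses (sep_f1 : sep f1) (nu_f1 : nu f1 = Some b).
Hypothesis b_mu : (Some b <= mu :> xvalue alpha)%O.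

Lemma nu_Some f a : nu f = Some a -> exists2 f, ~~ supp alpha f & nu f = Some a.
Proof.
move=> e; exists f => //; rewrite suppE; apply/eqP => /nu_None.
by rewrite e.
Qed.

Lemma nonsep_value g : ~ sep g -> exists a, [/\ nu g = Some a,
  (Some a < Some b :> xvalue alpha)%O & (Some a < mu :> xvalue alpha)%O].
Proof.
move=> ng; have [g0 _] := sep_neq0 ng; have lt := sep_nu_lt ng sep_f1.
case e : (nu g) => [a|]; last by move/nu_None: e g0 => ->; rewrite eqxx.
by rewrite e nu_f1 in lt; exists a; split=> //; apply: lt_le_trans lt b_mu.
Qed.

(** By the dimension hypothesis, two different monomials of equal value [a] have a combination [h]
    of larger value that involves ['X_[m1]]. A monomial ideal of elements of value above [a] that
    contains [h] then contains ['X_[m1]], which is absurd. *)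
Lemma nu_monomial_inj m0 m1 : ~ sep 'X_[m0] -> nu 'X_[m0] = nu 'X_[m1] -> m0 = m1.
Proof.
move=> n0 e; apply/eqP; apply: contraT => m01.
have [a [ea ab amu]] := nonsep_value n0.
have [x [Ux indep span]] := dim1_lt (nu_Some ea) amu.
have [c0 h0] : exists c : 'I_1 -> R, nu_gt a ('X_[m0] - \sum_i c i *: x i).
  by apply: span; rewrite /nu_ge /= ea.
have [c1 h1] : exists c : 'I_1 -> R, nu_gt a ('X_[m1] - \sum_i c i *: x i).
  by apply: span; rewrite /nu_ge /= -e ea.
move: h0 h1; rewrite !big_ord1; set y := x ord0.
move: (c0 ord0) (c1 ord0) => {c0 c1} c0 c1 h0 h1.
have X0 : sper_mor alpha 'X_[m0] != 0 by have [] := sep_neq0 n0.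
have [_ ID _] := nu_gt_ideal X0; have IZ := idealZ _ (nu_gt_ideal X0).
have gtE f : nu_gt a f = [set h | (nu 'X_[m0] < nu h)%O] f by rewrite /nu_gt /= ea.
have c0n : c0 != 0.
  apply: contraT; rewrite negbK => /eqP c00.
  by move: h0; rewrite gtE c00 scale0r subr0 /= ltxx.
pose h := c1 *: 'X_[m0] - c0 *: 'X_[m1] : A.
have hgt : nu_gt a h.
  have -> : h = c1 *: ('X_[m0] - c0 *: y) + (- c0) *: ('X_[m1] - c1 *: y).
    rewrite /h !scalerBr !scaleNr !opprK !scalerA [c1 * c0]mulrC.
    by rewrite addrACA addNr addr0.
  by rewrite gtE; apply: ID; apply: IZ; rewrite -gtE.
have hm1 : m1 \in msupp h.
  rewrite mcoeff_msupp /h mcoeffB !mcoeffZ !mcoeffX eqxx (negPf m01).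
  by rewrite mulr0 mulr1 sub0r oppr_eq0.
(* Monomiality is known only up to [mu]: the ideal is taken at the value of [h] if this is at most
   [b], and at [b] otherwise. *)
have [le|le] := orP (le_total (nu h) (Some b : xvalue alpha)).
  case eh : (nu h) => [b'|]; last by move: le; rewrite eh.
  have b'mu : (Some b' <= mu :> xvalue alpha)%O by rewrite -eh; apply: le_trans b_mu.
  have := monomial_ideal_msupp (monomial_le (nu_Some eh) b'mu) _ hm1.
  rewrite /nu_ge /= eh -e ea => /(_ (lexx _)) le'.
  by move: hgt; rewrite /nu_gt /= eh ltNge le'.
have := monomial_ideal_msupp (monomial_le (nu_Some nu_f1) b_mu) le hm1.
by rewrite /nu_ge /= -e ea leNgt ab.
Qed.

(** As the ideal at the value of [g] is monomial, no monomial of [g] has smaller value. Some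
    monomial attains it, for otherwise [g] would have larger value, and [nu_monomial_inj] makes it
    unique. *)
Lemma dominant_monomial g : ~ sep g -> exists m0, [/\ m0 \in msupp g,
  nu 'X_[m0] = nu g &
  forall m, m \in msupp g -> m != m0 -> (nu 'X_[m0] < nu 'X_[m])%O].
Proof.
move=> ng; have [a [ea ab amu]] := nonsep_value ng.
have [g0 _] := sep_neq0 ng.
have ge m : m \in msupp g -> (nu g <= nu 'X_[m])%O.
  have := monomial_ideal_msupp (monomial_le (nu_Some ea) (ltW amu)) _.
  by move=> /(_ g m); rewrite /nu_ge /= ea; apply.
have [m0 m0g e0] : exists2 m0, m0 \in msupp g & nu 'X_[m0] = nu g.
  apply: contrapT => no; suff : (nu g < nu g)%O by rewrite ltxx.
  apply: (ideal_msupp (nu_gt_ideal g0)) => m mg /=.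
  rewrite lt_neqAle (ge _ mg) andbT; apply/eqP => e; apply: no.
  by exists m; [exact: mg|exact: esym e].
have n0 : ~ sep 'X_[m0] by move=> /(sep_nu_lt ng); rewrite e0 ltxx.
exists m0; split=> [//|//|m mg mm0]; rewrite lt_neqAle; apply/andP; split.
  by apply/eqP => /(nu_monomial_inj n0) e; rewrite e eqxx in mm0.
by rewrite e0; apply: ge.
Qed.

Lemma sepX_divisor m j : ~ sep 'X_[m] -> m j != 0%N -> ~ sep 'X_j.
Proof.
by move=> nm mj sj; apply: nm; rewrite -(@submK _ U_(j) m) ?lep1mP // mpolyXD;
  apply: sepM.
Qed.

(** Elements of the separating ideal have value above that of [g]; removing the term in [m], also of
    larger value, would leave ['X_[m0]] with too large a value. *)
Lemma nonsep_perturb g m0 m (e c : R) : ~ sep g -> nu 'X_[m0] = nu g ->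
  (nu 'X_[m0] < nu 'X_[m])%O -> e * e = 1 ->
  ~ sep (e *: 'X_[m0] + c *: 'X_[m]).
Proof.
move=> ng e0 lt ee sh; have [g0 _] := sep_neq0 ng.
have hI := nu_gt_ideal g0; have [_ ID _] := hI; have IZ := idealZ _ hI.
suff : (nu g < nu 'X_[m0])%O by rewrite e0 ltxx.
have -> : 'X_[m0] = e *: ((e *: 'X_[m0] + c *: 'X_[m]) + (- c) *: 'X_[m]) :> A.
  by rewrite scaleNr addrK scalerA ee scale1r.
apply: (IZ); apply: ID; first exact: sep_nu_lt sh.
by apply: IZ; rewrite /= -e0.
Qed.

End Dominance.

(** * The connected set *)

Lemma norm_ratio_le (F : realFieldType) (a b x y : F) k : b != 0 ->
  `|a / b *+ k| * `|x| < `|y| -> `|a * x| *+ k <= `|b * y|.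
Proof.
rewrite -normr_gt0 normrMn !normrM normfV => b0 lt.
by rewrite -mulrnAl [X in _ <= X]mulrC -ler_pdivrMr // mulrAC mulrnAl ltW.
Qed.

(** There are only [size r] minus one other terms, too few to cancel [a x0]. *)
Lemma dominated_sum_neq0 (T : eqType) (F : realFieldType) (r : seq T) (a : T -> F) x0 :
  uniq r -> x0 \in r -> a x0 != 0 ->
  (forall x, x \in r -> x != x0 -> `|a x| *+ size r <= `|a x0|) ->
  \sum_(x <- r) a x != 0.
Proof.
move=> ur x0r a0 dom; rewrite (big_rem x0) //= addr_eq0; apply/eqP => e.
have sz : size r = (size (rem x0 r)).+1 by rewrite size_rem // prednK //; case: (r) x0r.
have : `|a x0| *+ size r <= `|a x0| *+ size (rem x0 r).
  have -> : `|a x0| *+ size (rem x0 r) = \sum_(x <- rem x0 r) `|a x0|.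
    by rewrite big_const_seq count_predT iter_addr_0.
  rewrite {1}e normrN; apply: le_trans (_ : _ <= (\sum_(x <- rem x0 r) `|a x|) *+ size r) _.
    by rewrite lerMn2r ler_norm_sum orbT.
  rewrite -sumrMnl big_seq [X in _ <= X]big_seq; apply: ler_sum => x.
  by rewrite mem_rem_uniq // inE => /andP[xx0 xr]; apply: dom.
by rewrite sz mulrS gerDr normr_le0 (negPf a0).
Qed.

Lemma sper_mor_monomial (R : comNzRingType) (n : nat) (delta : sper {mpoly R[n]})
    (m : 'X_{1..n}) :
  sper_mor delta 'X_[m] = mmap1 (fun j => sper_mor delta 'X_j) m.
Proof.
rewrite -[in LHS]mmap1_id /mmap1 rmorph_prod.
by apply: eq_bigr => j _; rewrite rmorphXn.
Qed.

Lemma region_sper (R : rcfType) (n : nat) (J : pred 'I_n) (sg : 'I_n -> R)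
    (cs : seq (R * ('X_{1..n} * 'X_{1..n}))) (delta : sper {mpoly R[n]}) :
  (forall j, `|sg j| = 1) ->
  (forall k, k \in cs -> forall j, ~~ J j -> k.2.2 j = 0%N) ->
  pos_locus (region J sg cs) delta <->
  (forall j, J j -> 0 < sper_mor delta (sg j *: 'X_j)) /\
  (forall k, k \in cs ->
    `|sper_mor delta (k.1 *: 'X_[k.2.1])| < `|sper_mor delta 'X_[k.2.2]|).
Proof.
move=> sgP cs_supp; pose phi := sper_mor delta.
pose h : {rmorphism R -> sfrac delta} :=
  GRing.RMorphism.clone _ _ (phi \o @mpolyC n R) _.
pose v j := phi 'X_j.
have phiE f : phi f = mmap h v f by rewrite -(@mpoly_morph _ _ _ phi h v).
have hd : realizes delta (mmap h v) by move=> f; rewrite -phiE realizes_sper_mor.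
rewrite (realizes_pos_locus hd) (region_mmap sgP cs_supp).
have scale c f : phi (c *: f) = h c * phi f by rewrite -mul_mpolyC rmorphM.
split=> -[hJ hk]; split.
- by move=> j /hJ; rewrite -/phi scale.
- move=> k /hk; rewrite -/phi scale normrM /phi !sper_mor_monomial.
  by rewrite !mmap1_norm.
- by move=> j /hJ; rewrite -/phi scale.
move=> k /hk; rewrite -/phi scale normrM /phi !sper_mor_monomial.
by rewrite !mmap1_norm.
Qed.

Theorem theorem4p1 (R : rcfType) (n : nat) (alpha beta : sper {mpoly R[n]})
    (mu : xvalue alpha) (mu_def : mu = nu_min alpha (sep_ideal alpha beta))
    (monomial_le : forall a : value_group alpha,
      (exists2 f, ~~ supp alpha f & nu alpha f = Some a) ->
      (Some a <= mu :> xvalue alpha)%O -> monomial_ideal (nu_ge a))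
    (dim1_lt : forall a : value_group alpha,
      (exists2 f, ~~ supp alpha f & nu alpha f = Some a) ->
      (Some a < mu :> xvalue alpha)%O -> quot_dim (nu_ge a) (nu_gt a) 1)
    (s : nat) (g : 'I_s -> {mpoly R[n]})
    (g_notin : forall i, ~ sep_ideal alpha beta (g i)) :
  exists C : set (sper {mpoly R[n]}),
    [/\ connected C, C alpha, C beta & forall i, C `&` zeros (g i) = set0].
Proof.
set sep := sep_ideal alpha beta in mu_def g_notin.
have zerosE delta f : zeros f delta <-> sper_mor delta f = 0.
  rewrite /zeros /=; split=> [/eqP|/eqP].
    by rewrite (realizes_eq0 (realizes_sper_mor delta)) => /eqP.
  by rewrite -(realizes_eq0 (realizes_sper_mor delta)) => /eqP.
(* If the separating ideal vanishes at [alpha], then [alpha] lies in the closure of [beta] and the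
   two points alone form a connected set. *)
have [triv|] := pselect (forall f, sep f -> sper_mor alpha f = 0).
  exists [set alpha; beta]; split; [exact: sep_trivial_connected|by left|by right|].
  move=> i; have [ga gb] := sep_neq0 (g_notin i).
  apply/seteqP; split=> // delta [[->|->] /zerosE g0].
    by rewrite g0 eqxx in ga.
  by rewrite g0 eqxx in gb.
move=> /existsNP[f0 /not_implyP[sf0 /eqP f00]].
have [f1 [b [sf1 ef1 b_mu]]] := sep_nu_min sf0 f00.
rewrite -mu_def in b_mu.
have inj := nu_monomial_inj monomial_le dim1_lt sf1 ef1 b_mu.
have [m0 hm0] := choice (fun i =>
  dominant_monomial monomial_le dim1_lt sf1 ef1 b_mu (g_notin i)).
have nm0 i : ~ sep 'X_[m0 i].
  have [_ e _] := hm0 i.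
  by move=> /(sep_nu_lt (g_notin i)); rewrite e ltxx.
pose J : pred 'I_n := fun j => `[< ~ sep 'X_j >].
pose sg j : R := if 0 < sper_mor alpha 'X_j then 1 else -1.
have sgP j : `|sg j| = 1 by rewrite /sg; case: ifP; rewrite ?normrN normr1.
have sg2 j : sg j * sg j = 1 by rewrite /sg; case: ifP; rewrite ?mulrNN mulr1.
(* The number of terms enters as a factor so that the other terms, even added up, stay below the
   dominant one. *)
pose coef i m := (g i)@_m / (g i)@_(m0 i) *+ size (msupp (g i)).
pose cs : seq (R * ('X_{1..n} * 'X_{1..n})) := flatten
  [seq [seq (coef i m, (m, m0 i)) | m <- msupp (g i) & m != m0 i] | i <- enum 'I_s].
have csP k : k \in cs <-> exists i m, [/\ m \in msupp (g i), m != m0 i &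
    k = (coef i m, (m, m0 i))].
  split=> [/flattenP[_ /mapP[i _ ->] /mapP[m]]|[i [m [mg mm0 ->]]]].
    by rewrite mem_filter => /andP[mm0 mg] ->; exists i, m.
  apply/flattenP; exists [seq (coef i m, (m, m0 i)) | m <- msupp (g i) & m != m0 i].
    by apply: map_f; rewrite mem_enum.
  by apply/mapP; exists m => //; rewrite mem_filter mm0.
have supp0 i j : ~~ J j -> m0 i j = 0%N.
  move=> /asboolP nJ; apply/eqP; apply: contraT => mj; case: nJ.
  exact: sepX_divisor (nm0 i) mj.
have cs_supp k : k \in cs -> forall j, ~~ J j -> k.2.2 j = 0%N.
  by move=> /csP[i [m [_ _ ->]]] j nJ; apply: (supp0 i).
have lt_m i m : m \in msupp (g i) -> m != m0 i ->
    (nu alpha 'X_[m0 i] < nu alpha 'X_[m])%O.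
  by move=> mg mm0; have [_ _] := hm0 i; apply.
(* The monomial [1] is outside the separating ideal too, so ['X_j] differs from it in value and is
   infinitely small at [alpha]. *)
have Jlt j : J j -> forall z, sper_mor alpha z * `|sper_mor alpha 'X_j| < 1.
  move=> /asboolP nj; have n1 : ~ sep 1 by move=> /(sepM 'X_j); rewrite mulr1.
  have lt1 : (nu alpha 1 < nu alpha 'X_j)%O.
    rewrite lt_neqAle; apply/andP; split.
      apply/eqP; rewrite -mpolyX0 => /inj; rewrite mpolyX0 => /(_ n1) e.
      by have := congr1 (fun m : 'X_{1..n} => m j) e; rewrite mnm0E mnm1E eqxx.
    by rewrite -['X_j]mulr1; apply: nu_leM.
  by move=> z; have := (nu_ltE _ _ _).1 lt1 z; rewrite rmorph1 normr1.
have [u hu] : exists u : 'I_n -> nat, forall k, k \in cs ->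
    (\sum_j k.2.2 j * u j < \sum_j k.2.1 j * u j)%N.
  have [| | |k|u hu] := @monomial_weights n (sfrac alpha)
    (fun x => exists z, x = sper_mor alpha z) (fun j => sper_mor alpha 'X_j) J (map snd cs).
  - by move=> j /asboolP nj; exact: (sep_neq0 nj).1.
  - by exists 1; rewrite rmorph1.
  - by move=> j Jj _ [z ->]; apply: Jlt.
  - move=> /mapP[_ /csP[i [m [mg mm0 ->]]] ->] /=; split=> [j|_ [z ->]].
      exact: supp0.
    rewrite -!sper_mor_monomial; exact: ((nu_ltE _ _ _).1 (lt_m _ _ mg mm0)).
  by exists u => k kcs; apply: hu; apply: map_f.
have Ca : pos_locus (region J sg cs) alpha.
  apply/(region_sper _ sgP cs_supp); split=> [j /asboolP nj|k /csP[i [m [mg mm0 ->]]] /=].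
    have [x0 _] := sep_neq0 nj; rewrite /sg; case: ifP => [h|/negbT].
      by rewrite scale1r.
    by rewrite -leNgt scaleN1r rmorphN oppr_gt0 lt_neqAle x0.
  rewrite -mul_mpolyC rmorphM normrM.
  have := (nu_ltE _ _ _).1 (lt_m _ _ mg mm0) (`|coef i m|)%:MP.
  apply: le_lt_trans; rewrite ler_wpM2r //.
  have := nonneg_morph_norm (rcf_morph_ge0 (GRing.RMorphism.clone _ _
    (sper_mor alpha \o @mpolyC n R) _)) (coef i m).
  by move=> /= ->.
exists (pos_locus (region J sg cs)); split.
- exact: region_connected sgP cs_supp hu.
- exact: Ca.
(* Each defining polynomial is positive at [alpha] and lies outside the separating ideal, hence is
   positive at [beta]. *)
- apply/(realizes_pos_locus (realizes_sper_mor beta)) => f fr.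
  apply: (@sep_pos _ alpha); last first.
    exact: (realizes_pos_locus (realizes_sper_mor alpha) _).1 Ca f fr.
  have mm1 m : mmap1 sg m * mmap1 sg m = 1.
    rewrite /mmap1 -big_split big1 // => j _.
    by rewrite /= -exprMn sg2 expr1n.
  move: fr; rewrite !mem_cat => /orP[/mapP[j]|].
    rewrite mem_filter => /andP[/asboolP nj _] -> /(sepM (sg j)%:MP).
    by rewrite mul_mpolyC scalerA sg2 scale1r.
  case/orP=> /mapP[_ /csP[i [m [mg mm0 ->]]] ->]; have [_ e _] := hm0 i.
    rewrite -scaleNr; exact: nonsep_perturb (g_notin i) e (lt_m _ _ mg mm0) (mm1 _).
  exact: nonsep_perturb (g_notin i) e (lt_m _ _ mg mm0) (mm1 _).
move=> i; apply/seteqP; split=> // delta [Cd /zerosE].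
have [hJ hcs] := (region_sper _ sgP cs_supp).1 Cd.
have [m0g _ _] := hm0 i.
have c0 : (g i)@_(m0 i) != 0 by rewrite -mcoeff_msupp.
have V0 : sper_mor delta 'X_[m0 i] != 0.
  rewrite sper_mor_monomial; apply/prodf_neq0 => j _.
  have [Jj|/(supp0 i) ->] := boolP (J j); last by rewrite expr0 oner_neq0.
  apply: expf_neq0; apply: contraTneq (hJ j Jj).
  by rewrite -mul_mpolyC rmorphM => ->; rewrite mulr0 ltxx.
pose h : {rmorphism R -> sfrac delta} :=
  GRing.RMorphism.clone _ _ (sper_mor delta \o @mpolyC n R) _.
have scale c (f : {mpoly R[n]}) : sper_mor delta (c *: f) = h c * sper_mor delta f.
  by rewrite -mul_mpolyC rmorphM.
have cK : h (g i)@_(m0 i) != 0 by rewrite fmorph_eq0.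
pose t m := h (g i)@_m * sper_mor delta 'X_[m].
have -> : sper_mor delta (g i) = \sum_(m <- msupp (g i)) t m.
  rewrite {1}[g i]mpolyE rmorph_sum; apply: eq_bigr => m _; exact: scale.
suff : \sum_(m <- msupp (g i)) t m != 0 by move/eqP.
have t0 : t (m0 i) != 0 by exact: mulf_neq0 cK V0.
apply: (dominated_sum_neq0 (msupp_uniq _) m0g t0) => m mg mm0.
have := hcs (coef i m, (m, m0 i)).
rewrite (proj2 (csP _)); last by exists i, m.
move=> /(_ isT) /=; rewrite scale normrM /coef rmorphMn rmorphM fmorphV.
move=> lt; exact: (norm_ratio_le cK lt).
Qed.
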